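(* Let $(\Gamma,<_1,<_2,<_3)$ be a primitive homogeneous 3-dimensional permutation structure. Then there is a nonempty set $S\subseteq\{1,2,3\}$ such that each $<_j$ ($j=1,2,3$) equals $<_i$ or $<_i^{opp}$ for some $i\in S$, and $(\Gamma,(<_i)_{i\in S})$ is the generic $|S|$-dimensional permutation structure. (That is, $\Gamma$ is obtained by identifying certain orders up to reversal and taking the generic structure.)
   Context: A 3-dimensional permutation structure is $(\Gamma,<_1,<_2,<_3)$ with each $<_i$ a linear order; homogeneous means countably infinite with every isomorphism between finite substructures extending to an automorphism. Primitive means there is no $\emptyset$-definable equivalence relation other than equality and the total relation. The generic $k$-dimensional permutation structure is the Fraïssé limit of the class of all finite structures with $k$ linear orders. $<^{opp}$ denotes the reverse of $<$. *)

(* Defs.v *)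
From mathcomp Require Import all_boot.
From mathcomp Require Import boolp classical_sets functions cardinality.
From Corelib Require Import RelationClasses.

Set Implicit Arguments.
Unset Strict Implicit.
Unset Printing Implicit Defensive.

Local Open Scope classical_set_scope.
Local Open Scope card_scope.

(* Structures for a relational language of binary symbols indexed by I. *)
Record structure (I : Type) := Structure {
  carrier :> Type;
  srel : I -> carrier -> carrier -> Prop }.

(* The structure (M, (R_(f j))_(j : J)). *)
Definition reduct (I J : Type) (f : J -> I) (M : structure I) : structure J :=
  Structure (fun j : J => @srel I M (f j)).

Definition opp_rel (T : Type) (R : T -> T -> Prop) : T -> T -> Prop :=
  fun x y => R y x.

(* Linear orders in strict form. *)
Definition linear_order (T : Type) (R : T -> T -> Prop) : Prop :=
  [/\ (forall x, ~ R x x),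
      (forall x y z, R x y -> R y z -> R x z) &
      (forall x y, x <> y -> R x y \/ R y x)].

Definition permutation_structure (k : nat) (M : structure 'I_k) : Prop :=
  forall i : 'I_k, linear_order (srel (s := M) i).

Section Homogeneity.
Variable I : Type.
Implicit Types M A : structure I.

Definition embedding A M (f : A -> M) : Prop :=
  injective f /\ forall i x y, srel i x y <-> srel i (f x) (f y).

Definition automorphism M (g : M -> M) : Prop :=
  bijective g /\ forall i x y, srel i x y <-> srel i (g x) (g y).

(* f restricts to an isomorphism from the substructure of M with domain A
   onto the one with domain B; the values of f outside A are irrelevant. *)
Definition partial_iso M (A B : set M) (f : M -> M) : Prop :=
  set_bij A B f /\
  forall i x y, A x -> A y -> (srel i x y <-> srel i (f x) (f y)).

Definition ultrahomogeneous M : Prop :=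
  forall (A B : set M) (f : M -> M),
    finite_set A -> finite_set B -> partial_iso A B f ->
    exists g : M -> M, automorphism g /\ forall x, A x -> g x = f x.

Definition homogeneous M : Prop :=
  [set: M] #= [set: nat] /\ ultrahomogeneous M.

Definition finite_structure A : Prop := finite_set [set: A].

(* The finite structures isomorphic to a substructure of M. *)
Definition age M A : Prop :=
  finite_structure A /\ exists f : A -> M, embedding f.

Definition fraisse_limit (K : structure I -> Prop) M : Prop :=
  [/\ countable [set: M], ultrahomogeneous M & forall A, age M A <-> K A].

End Homogeneity.

Definition generic_permutation_structure (k : nat) (M : structure 'I_k) : Prop :=
  fraisse_limit (fun A => finite_structure A /\ permutation_structure A) M.

(* First-order formulas with n free variables, in de Bruijn form: under a
   quantifier, variable 0 is the bound one and the others are shifted. *)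
Inductive formula (I : Type) : nat -> Type :=
| Eq n of 'I_n & 'I_n : formula I n
| Rel n of I & 'I_n & 'I_n : formula I n
| Not n of formula I n : formula I n
| And n of formula I n & formula I n : formula I n
| Exists n of formula I n.+1 : formula I n.

Fixpoint sat (I : Type) (M : structure I) (n : nat) (phi : formula I n) :
    n.-tuple M -> Prop :=
  match phi in formula _ m return m.-tuple M -> Prop with
  | Eq _ i j => fun v => tnth v i = tnth v j
  | Rel _ r i j => fun v => srel r (tnth v i) (tnth v j)
  | Not _ p => fun v => ~ sat p v
  | And _ p q => fun v => sat p v /\ sat q v
  | Exists _ p => fun v => exists a : M, sat p [tuple of a :: v]
  end.

(* Definability without parameters. *)
Definition definable_rel (I : Type) (M : structure I) (E : M -> M -> Prop) : Prop :=
  exists phi : formula I 2, forall x y, E x y <-> sat phi [tuple x; y].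

Definition primitive (I : Type) (M : structure I) : Prop :=
  forall E : M -> M -> Prop, Equivalence E -> definable_rel E ->
    (forall x y, E x y <-> x = y) \/ (forall x y, E x y).

(* Main.v *)
(** Homogeneity gives amalgamation over finite sets, and primitivity says that
    a symmetric union of some but not all of the realized types of pairs of
    distinct points is never, together with equality, transitive.  Keeping one
    order from each class up to reversal, at most three orders remain, pairwise
    distinct up to reversal; for these, the two principles applied to patterns
    with at most five points force all patterns with at most four points to
    occur.  This finite case analysis is recorded in decision trees checked by
    computation.  Larger patterns reduce to smaller ones: a box cut out by
    [n >= 4] points, more than there are orders, has at most two neighbours in
    each order, hence some point [y] is its neighbour in at most one order [i];
    one auxiliary point between [y] and the box in the order [i] then makes the
    amalgam of the box with [y] unique. *)

Require Import Defs.
From mathcomp Require Import boolp classical_sets functions cardinality.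
From Corelib Require Import RelationClasses.
From mathcomp Require Import all_boot zify.

Set Implicit Arguments.
Unset Strict Implicit.
Unset Printing Implicit Defensive.

(** Genericity is reduced to a statement about boxes: for finitely many points and a consistent
    choice of a side of each point in each order, some point lies on all the chosen sides. The
    induction on the number of points meets one obstacle. A point of the box cut out by all the
    points but [y] may fall on the wrong side of [y], or be [y] itself, in the orders where [y]
    bounds the box; one such order can be repaired by an auxiliary point, and counting shows that a
    suitable [y] has no more than one. The induction starts from three points for two reasons: the
    counting needs more points than orders, and placing the auxiliary point needs three points
    besides [y], two of them on the same side of [y]. By homogeneity, a box over three points is a
    matter of four-point patterns.

    The decision trees carry no authority. Only the checker is proved sound, so trees may be stored,
    generated during the computation, or obtained from other trees by permuting and reversing the
    orders; each is checked before it is used. *)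

Section LinearOrder.
Variables (T : Type) (R : T -> T -> Prop).
Hypothesis linR : linear_order R.

Lemma lin_irr x : ~ R x x.
Proof. by case: linR => irr _ _; apply: irr. Qed.

Lemma lin_trans y x z : R x y -> R y z -> R x z.
Proof. by case: linR => _ tr _; apply: tr. Qed.

Lemma lin_total x y : x <> y -> R x y \/ R y x.
Proof. by case: linR => _ _; apply. Qed.

Lemma lin_asym x y : R x y -> ~ R y x.
Proof. by move=> xy yx; apply: (@lin_irr x); apply: lin_trans yx. Qed.

Lemma lin_notr x y : x <> y -> ~ R x y -> R y x.
Proof. by move=> ne nxy; case: (lin_total ne). Qed.

End LinearOrder.

(** * Boxes and one-point extensions in homogeneous structures *)

Section Homogeneous.
Variables (k : nat) (M : structure 'I_k.+1).
Hypothesis Mperm : permutation_structure M.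
Hypothesis Mhom : ultrahomogeneous M.

(** In a strict linear order, points are equal exactly when neither lies below the other, so a
    correspondence preserving an order is well defined and injective. *)
Lemma same_rel_eq (I : Type) (u v : I -> M) (s t : I) :
  (forall i, srel i (u s) (u t) <-> srel i (v s) (v t)) ->
  (forall i, srel i (u t) (u s) <-> srel i (v t) (v s)) ->
  u s = u t -> v s = v t.
Proof.
move=> st ts e; apply: contrapT => /(lin_total (Mperm ord0)) [].
  by move/(st ord0).2; rewrite e => /(lin_irr (Mperm _)).
by move/(ts ord0).2; rewrite e => /(lin_irr (Mperm _)).
Qed.

(** Homogeneity for indexed families, which may repeat values: [same_rel_eq], used in both
    directions, makes [u s] to [v s] a bijection between the two sets of values. *)
Lemma extend_seq (I : eqType) (D : seq I) (u v : I -> M) :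
  (forall i s t, s \in D -> t \in D ->
     srel i (u s) (u t) <-> srel i (v s) (v t)) ->
  exists2 g : M -> M, automorphism g & forall s, s \in D -> g (u s) = v s.
Proof.
move=> uv.
pose h m := if pselect (exists2 s, s \in D & u s = m) is left e
            then v (s2val (cid2 e)) else m.
have hu s : s \in D -> h (u s) = v s.
  move=> sD; rewrite /h; case: pselect => [e|[]]; last by exists s.
  case: (cid2 e) => t tD /= tu.
  by apply: (@same_rel_eq _ u v) => // i; apply: uv.
have [|||g [ga gu]] :=
    @Mhom [set u s | s in [set` D]]%classic [set v s | s in [set` D]]%classic h.
- exact/finite_image/finite_seqP/(ex_intro _ D).
- exact/finite_image/finite_seqP/(ex_intro _ D).
- split; last first.
    by move=> i _ _ [s sD <-] [t tD <-]; rewrite !hu //; apply: uv.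
  split.
  + by move=> _ [s sD <-]; rewrite hu //; exists s.
  + move=> _ _ /set_mem [s sD <-] /set_mem [t tD <-]; rewrite !hu // => e.
    apply: (@same_rel_eq _ v u) => // i; apply: iff_sym; exact: uv.
  + by move=> _ [s sD <-]; exists (u s); [exists s|rewrite hu].
by exists g => // s sD; rewrite gu ?hu //; exists s.
Qed.

(* The new point is to lie above [a t] in the order [i] exactly when [c i t]. *)
Definition one_point_extension (m : nat) : Prop :=
  forall (T : finType) (a : T -> M) (P : {set T}) (c : 'I_k.+1 -> T -> bool),
    #|P| <= m ->
    {in P &, injective a} ->
    (forall i, {in P &, forall s t, srel i (a s) (a t) -> c i t -> c i s}) ->
    exists x, forall i, {in P, forall t,
      if c i t then srel i (a t) x else srel i x (a t)}.

(** The points bounding the box in the order [i]: no point of [P] on the same side is closer to the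
    box. *)
Definition near (T : finType) (a : T -> M) (P : {set T})
    (c : 'I_k.+1 -> T -> bool) i t :=
  `[< forall s, s \in P -> c i s = c i t ->
        ~ (if c i t then srel i (a t) (a s) else srel i (a s) (a t)) >].

Lemma near_le2 (T : finType) (a : T -> M) (P : {set T}) c i :
  {in P &, injective a} -> #|[set t in P | near a P c i t]| <= 2.
Proof.
move=> a_inj.
have le1 b : #|[set t in P | near a P c i t & c i t == b]| <= 1.
  apply/card_le1_eqP => s t; rewrite !inE.
  move=> /and3P [sP ns /eqP cs] /and3P [tP nt /eqP ct].
  apply: contrapT => /eqP st.
  have /(lin_total (Mperm i)) : a s <> a t.
    by move/a_inj=> e; rewrite e ?eqxx in st.
  move: ns nt => /asboolP /(_ t tP) + /asboolP /(_ s sP).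
  by rewrite cs ct; case: b {cs ct} => /(_ erefl) ? /(_ erefl) ? [].
apply: leq_trans (leq_add (le1 true) (le1 false)).
rewrite -cardsUI; apply: leq_trans (leq_addr _ _); apply/subset_leq_card.
apply/fintype.subsetP=> t; rewrite !inE => /andP [-> ->] /=.
by case: (c i t).
Qed.


(** Double counting of the pairs of a point and an order in which it bounds the box: there are at
    most two for each order, but there would be at least two for each point. *)
Lemma exists_near_le1 (T : finType) (a : T -> M) (P : {set T}) c :
  {in P &, injective a} -> k.+1 < #|P| ->
  exists2 y, y \in P & #|[set i | near a P c i y]| <= 1.
Proof.
move=> a_inj ltkP; apply: contrapT => no_y.
have : \sum_(y in P) 2 <= \sum_(y in P) #|[set i | near a P c i y]|.
  apply: leq_sum => y yP; rewrite ltnNge; apply/negP => le1.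
  by apply: no_y; exists y.
rewrite leqNgt => /negP; apply.
under eq_bigr => y _ do rewrite -sum1_card big_mkcond /=.
rewrite exchange_big /= sum_nat_const.
apply: (@leq_ltn_trans (\sum_(i < k.+1) 2)); last first.
  by rewrite sum_nat_const card_ord ltn_mul2r.
apply: leq_sum => i _.
apply: leq_trans (near_le2 c i a_inj).
rewrite -sum1_card (big_mkcond (fun y => y \in P)) /= [leqRHS]big_mkcond /=.
by apply: leq_sum => y _; rewrite !inE; case: (y \in P).
Qed.

(** Pigeonhole on three points other than [y]; of the two on the same side, [s] is the one closer to
    [y]. *)
Lemma two_same_side (T : finType) (a : T -> M) (P : {set T}) i y :
  {in P &, injective a} -> y \in P -> 3 < #|P| ->
  exists w s, [/\ w \in P :\ y, s \in P :\ y &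
    (srel i (a w) (a s) /\ srel i (a s) (a y)) \/
    (srel i (a y) (a s) /\ srel i (a s) (a w))].
Proof.
move=> a_inj yP; rewrite (cardsD1 y) yP add1n ltnS => le3.
have [s0 [s1 [s2 [[s0P s1P s2P] [n01 n12 n02]]]]] : exists s0 s1 s2,
    [/\ s0 \in P :\ y, s1 \in P :\ y & s2 \in P :\ y] /\
    [/\ s0 != s1, s1 != s2 & s0 != s2].
  have [s0 s0P] : exists s0, s0 \in P :\ y.
    by apply/card_gt0P; apply: leq_trans le3.
  move: le3; rewrite (cardsD1 s0) s0P ltnS => le2.
  have [s1 s1P] : exists s1, s1 \in P :\ y :\ s0.
    by apply/card_gt0P; apply: leq_trans le2.
  move: le2; rewrite (cardsD1 s1) s1P ltnS => /card_gt0P [s2].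
  rewrite in_setD1 => /andP [n21]; rewrite in_setD1 => /andP [n20 s2P].
  move: s1P; rewrite in_setD1 => /andP [n10 s1P].
  by exists s0, s1, s2; split; split; rewrite // eq_sym.
have tot u v : u \in P :\ y -> v \in P -> u != v ->
    srel i (a u) (a v) \/ srel i (a v) (a u).
  move=> /setD1P [_ uP] vP uv; apply: (lin_total (Mperm i)).
  by move/(a_inj _ _ uP vP)=> e; rewrite e eqxx in uv.
have [ny0 ny1 ny2] : [/\ s0 != y, s1 != y & s2 != y].
  by split; [move: s0P|move: s1P|move: s2P] => /setD1P [].
have pair u v : u \in P :\ y -> v \in P :\ y -> u != v ->
    (srel i (a u) (a y) /\ srel i (a v) (a y)) \/
    (srel i (a y) (a u) /\ srel i (a y) (a v)) ->
    exists w s, [/\ w \in P :\ y, s \in P :\ y &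
    (srel i (a w) (a s) /\ srel i (a s) (a y)) \/
    (srel i (a y) (a s) /\ srel i (a s) (a w))].
  move=> uP vP nuv; have vP' := fintype.subsetP (subD1set _ _) _ vP.
  case: (tot _ _ uP vP' nuv) => uv [[]|[]] ? ?.
  - by exists u, v; split => //; left.
  - by exists v, u; split => //; right.
  - by exists v, u; split => //; left.
  - by exists u, v; split => //; right.
case: (tot _ _ s0P yP ny0) (tot _ _ s1P yP ny1) (tot _ _ s2P yP ny2)
  => [? [?|?] [?|?]|? [?|?] [?|?]].
all: try by apply: (pair s0 s1) => //; tauto.
all: try by apply: (pair s1 s2) => //; tauto.
all: by apply: (pair s0 s2) => //; tauto.
Qed.

(** Some point of [P] lies between [y] and the box, and transitivity through it decides the position
    of [x]. *)
Lemma not_near (T : finType) (a : T -> M) (P : {set T}) c i y x :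
  y \in P -> ~~ near a P c i y ->
  {in P :\ y, forall t,
      if c i t then srel i (a t) x else srel i x (a t)} ->
  if c i y then srel i (a y) x else srel i x (a y).
Proof.
move=> yP /asboolPn/existsNP [s].
move=> /not_implyP [sP] /not_implyP [cs] /contrapT ys xP.
have sy : s \in P :\ y.
  apply/setD1P; split => //; apply/eqP => e; move: ys; rewrite e.
  by case: (c i y) => /(lin_irr (Mperm _)).
move: (xP s sy) ys; rewrite cs.
by case: (c i y) => ? ?; [apply: (lin_trans (Mperm i) (y := a s))
                          |apply: (lin_trans (Mperm i) (y := a s))].
Qed.

(* If the box is adjacent to [y] in one order [i] only, an auxiliary point [z]
   just beyond [y] in the order [i], seen from the rest of [P] as from a point
   [x] of the wanted kind, forces [x] to the right side of [y].  Both [z] and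
   its copy [z'] next to [x'] exist because, thanks to [s], their position with
   respect to [w] comes for free. *)
Lemma one_point_extension_near (m : nat) (T : finType) (a : T -> M)
    (P : {set T}) (c : 'I_k.+1 -> T -> bool) i y :
  3 < m.+1 -> #|P| = m.+1 ->
  one_point_extension m ->
  {in P &, injective a} ->
  (forall i, {in P &, forall s t, srel i (a s) (a t) -> c i t -> c i s}) ->
  y \in P -> near a P c i y -> (forall j, near a P c j y -> j = i) ->
  exists x, forall i, {in P, forall t,
    if c i t then srel i (a t) x else srel i x (a t)}.
Proof.
move=> m3 cardP EP a_inj c_cons yP near_y near_uniq.
have tot j u v : u \in P -> v \in P -> u != v ->
    ~ srel j (a u) (a v) -> srel j (a v) (a u).
  move=> uP vP uv; apply: (lin_notr (Mperm j)).
  by move/(a_inj _ _ uP vP)=> e; rewrite e eqxx in uv.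
have [w [s [wP sP wsy]]] : exists w s, [/\ w \in P :\ y, s \in P :\ y &
    (srel i (a w) (a s) /\ srel i (a s) (a y)) \/
    (srel i (a y) (a s) /\ srel i (a s) (a w))].
  by apply: two_same_side; rewrite // cardP.
move: (wP) (sP) => /setD1P [wy wP'] /setD1P [sy sP'].
have nsw : s != w.
  apply/eqP => e; rewrite e in wsy.
  by case: wsy => [] [] => [/(lin_irr (Mperm _))|? /(lin_irr (Mperm _))].
(* In an order [j] other than [i], the point [z] is put beyond all of [P], at the end for which [s]
   lies between [w] and [z]. In the order [i], [s] lies between [w] and [y], hence also between [w]
   and [z]. *)
pose d j t := if j == i then `[< srel i (a t) (a y) >] || (t == y) && c i y
              else `[< srel j (a w) (a s) >].
(* As [y] bounds the box, the rest of [P] lies on the same side of the box as of [y] in the order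
   [i]. *)
have cd t : t \in P :\ y -> c i t = d i t.
  move=> /setD1P [ty tP]; rewrite /d eqxx (negPf ty) orbF.
  have yt := tot i _ _ tP yP ty.
  move/asboolP: near_y => /(_ t tP).
  case cy: (c i y); case ct: (c i t) => // ny; apply/esym.
  - by apply/asboolP; apply: contrapT => nty; apply: ny (yt nty).
  - by apply/asboolPn => lt; rewrite (c_cons i _ _ tP yP lt cy) in ct.
  - apply/asboolP; apply: contrapT => nty.
    by rewrite (c_cons i _ _ yP tP (yt nty) ct) in cy.
  - by apply/asboolPn; apply: ny.
have d_cons j : {in P &, forall t u, srel j (a t) (a u) -> d j u -> d j t}.
  move=> t u tP uP tu; rewrite /d; case: ifP => // /eqP ji; subst j.
  case/orP => [/asboolP uy|/andP [/eqP uy _]].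
    by apply/orP; left; apply/asboolP/(lin_trans (Mperm i) tu).
  by apply/orP; left; apply/asboolP; rewrite -uy.
have side_w x : (forall j, if d j s then srel j (a s) x else srel j x (a s)) ->
    forall j, if d j w then srel j (a w) x else srel j x (a w).
  move=> sx j; move: (sx j); rewrite /d; have [->|_] := eqVneq j i.
    rewrite (negPf wy) (negPf sy) !orbF.
    case: wsy => [[ws sy']|[ys sw]].
      have wy' := lin_trans (Mperm i) ws sy'.
      by rewrite !asboolT // => /(lin_trans (Mperm i) ws).
    have yw := lin_trans (Mperm i) ys sw.
    rewrite !asboolF; first by move/(lin_trans (Mperm i)); apply.
      exact: (lin_asym (Mperm i)).
    exact: (lin_asym (Mperm i)).
  case: asboolP => [ws|/(tot _ _ _ wP' sP')].
    exact: (lin_trans (Mperm j) ws).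
  rewrite eq_sym => /(_ nsw) sw /(lin_trans (Mperm j)); exact.
have [z zP] : exists z, forall j, {in P, forall t,
    if d j t then srel j (a t) z else srel j z (a t)}.
  have [|||z zP] := EP T a (P :\ w) d.
  - by move: cardP; rewrite (cardsD1 w) wP' add1n => -[->].
  - by move=> t u /setD1P [_ tP] /setD1P [_ uP]; apply: a_inj.
  - by move=> j t u /setD1P [_ tP] /setD1P [_ uP]; apply: d_cons.
  exists z => j t tP; have [->|tw] := eqVneq t w; last by apply: zP; rewrite !inE tw.
  by apply: side_w => l; apply: zP; rewrite !inE nsw.
have [x' x'P] : exists x', forall j, {in P :\ y, forall t,
    if c j t then srel j (a t) x' else srel j x' (a t)}.
  apply: EP.
  - by move: cardP; rewrite (cardsD1 y) yP add1n => -[->].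
  - by move=> t u /setD1P [_ tP] /setD1P [_ uP]; apply: a_inj.
  - by move=> j t u /setD1P [_ tP] /setD1P [_ uP]; apply: c_cons.
pose a' := oapp a x'.
(* In the order [i], the point [z'] goes on the side of [x'] where [y] lies with respect to the
   box. *)
pose d' j o := if o is Some t then d j t else
  if j == i then ~~ c i y else `[< srel j (a w) (a s) >].
pose P' := None |: [set Some t | t in P :\ y :\ w].
have P'P o : o \in P' -> o = None \/ exists2 t, o = Some t & t \in P :\ y :\ w.
  rewrite !inE => /orP [/eqP ->|/imsetP [t tP ->]]; first by left.
  by right; exists t.
have [z' z'P] : exists z', forall j, {in P :\ y, forall t,
      if d j t then srel j (a t) z' else srel j z' (a t)} /\
    if c i y then srel i z' x' else srel i x' z'.
  have irr_x' t : t \in P :\ y -> a t <> x'.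
    move=> tP e; have := x'P i t tP; rewrite e.
    by case: (c i t) => /(lin_irr (Mperm _)).
  (* Here [x'] comes in, but both [y] and [w] are left out, so the hypothesis for [m] points
     applies. *)
  have [|||z' z'P] := EP _ a' P' d'.
  - rewrite /P' cardsU1 card_imset; last by move=> ? ? [].
    move: cardP; rewrite (cardsD1 y) yP (cardsD1 w) wP !add1n => -[<-].
    by rewrite -add1n leq_add2r leq_b1.
  - move=> o o' /P'P [->|[t -> /setD1P [_ tP]]] /P'P [->|[u -> /setD1P [_ uP]]] //=.
    + by move/esym/(irr_x' _ uP).
    + by move/(irr_x' _ tP).
    + move: tP uP => /setD1P [_ tP] /setD1P [_ uP] /(a_inj _ _ tP uP) -> //.
  - move=> j o o' /P'P [->|[t -> /setD1P [_ tP]]] /P'P [->|[u -> /setD1P [_ uP]]] //=.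
    + rewrite /d'; case: eqP => [->|/eqP/negPf ne]; last by rewrite /d ne.
      move=> lt; rewrite -(cd _ uP) => cu; have := x'P i u uP; rewrite cu.
      by move/(lin_asym (Mperm i)).
    + rewrite /d'; case: eqP => [->|/eqP/negPf ne]; last by rewrite /d ne.
      move=> lt _; rewrite -(cd _ tP); apply: contrapT => /negP/negPf ct.
      by have := x'P i t tP; rewrite ct => /(lin_asym (Mperm i)).
    + by move: tP uP => /setD1P [_ tP] /setD1P [_ uP]; apply: d_cons.
  exists z' => j; split; last first.
    have := z'P i None (setU11 _ _); rewrite /= eqxx.
    by case: (c i y).
  have z'S l t : t \in P :\ y -> t != w ->
      if d l t then srel l (a t) z' else srel l z' (a t).
    move=> tP tw; apply: (z'P l (Some t)); apply/setU1P; right.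
    by apply/imsetP; exists t; rewrite // in_setD1 tw.
  move=> t tP; have [->|] := eqVneq t w; last exact: z'S.
  by apply: side_w => l; apply: z'S.
have side (b : bool) j (u v : M) :
    (if b then srel j u v else srel j v u) ->
    (srel j u v <-> b) /\ (srel j v u <-> ~~ b).
  case: b => uv; split; split => //.
    by move/(lin_asym (Mperm j) uv).
  by move/(lin_asym (Mperm j) uv).
pose D := None :: map some (enum (P :\ y)).
have DP o : o \in D -> o = None \/ exists2 t, o = Some t & t \in P :\ y.
  rewrite inE => /orP [/eqP ->|/mapP [t]]; first by left.
  by rewrite mem_enum => tP ->; right; exists t.
(* Over [P] without [y], the points [z'] and [z] have the same type. The image of [x'] keeps its
   sides and is separated from [y] by [z] in the order [i]. *)
have [g [_ gh] gP] : exists2 g : M -> M, automorphism g &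
    forall o, o \in D -> g (oapp a z' o) = oapp a z o.
  apply: extend_seq => j o o' /DP [->|[t -> tP]] /DP [->|[u -> uP]] //=.
  - by split=> /(lin_irr (Mperm _)).
  - rewrite (side _ _ _ _ ((z'P j).1 u uP)).2 (side _ _ _ _ (zP j u _)).2 //.
    by case/setD1P: uP.
  - rewrite (side _ _ _ _ ((z'P j).1 t tP)).1 (side _ _ _ _ (zP j t _)).1 //.
    by case/setD1P: tP.
have gz : g z' = z by apply: (gP None); rewrite inE eqxx.
have ga t : t \in P :\ y -> g (a t) = a t.
  by move=> tP; apply: (gP (Some t)); rewrite inE map_f ?mem_enum.
have gx j : {in P :\ y, forall t,
    if c j t then srel j (a t) (g x') else srel j (g x') (a t)}.
  move=> t tP; rewrite -(ga _ tP); have := x'P j t tP.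
  by case: (c j t) => /gh.
exists (g x') => j t tP; have [->{t tP}|ty] := eqVneq t y; last first.
  by apply: gx; rewrite !inE ty.
have [/near_uniq ->|nj] := boolP (near a P c j y); last exact: not_near (gx j).
have := zP i y yP; rewrite /d !eqxx /= asboolF; last exact: (lin_irr (Mperm _)).
have := (z'P i).2; case: (c i y) => /gh; rewrite gz /=.
  by move=> zx yz; apply: lin_trans zx.
by move=> xz zy; apply: lin_trans zy.
Qed.

(** If the chosen [y] bounds the box in no order, [not_near] shows that every point of the box over
    the remaining points is on the right sides of [y]. *)
Lemma one_point_extension_succ (m : nat) : 2 < m -> k.+1 <= m ->
  one_point_extension m -> one_point_extension m.+1.
Proof.
move=> m3 km EP T a P c; rewrite leq_eqVlt ltnS => /orP [/eqP cardP|le];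
  last exact: EP.
move=> a_inj c_cons.
have [|y yP le1] := @exists_near_le1 T a P c a_inj; first by rewrite cardP ltnS.
have [[i]|no_near] := pselect (exists i, near a P c i y).
  move=> ni; apply: (one_point_extension_near (i := i) (y := y)) cardP EP _ _ _ _ _ => //.
  move=> j nj; move/card_le1_eqP: le1; apply; rewrite inE //.
have [|||x xP] := EP T a (P :\ y) c.
- by move: cardP; rewrite (cardsD1 y) yP add1n => -[->].
- by move=> t u /setD1P [_ tP] /setD1P [_ uP]; apply: a_inj.
- by move=> j t u /setD1P [_ tP] /setD1P [_ uP]; apply: c_cons.
exists x => j t tP; have [->|ty] := eqVneq t y; last first.
  by apply: xP; rewrite !inE ty.
apply: not_near (xP j) => //; apply/negP => nj; apply: no_near; by exists j.
Qed.

Lemma one_point_extension_all (m : nat) : 2 < m -> k.+1 <= m ->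
  one_point_extension m -> forall n, one_point_extension n.
Proof.
move=> m3 km EPm n; have : one_point_extension (m + n).
  elim: n => [|n IH]; first by rewrite addn0.
  rewrite addnS; apply: one_point_extension_succ IH.
    by apply: leq_trans m3 (leq_addr _ _).
  by apply: leq_trans km (leq_addr _ _).
by move=> EP T a P c le; apply: EP; apply: leq_trans (leq_addl _ _).
Qed.

End Homogeneous.

(** * From one-point extensions to the generic structure *)

Lemma finite_enum (T : Type) : finite_set [set: T]%classic ->
  exists n (x : 'I_n -> T), injective x /\ forall t, exists s, x s = t.
Proof.
case=> n /card_set_bijP [f [f_fun f_inj f_surj]]; exists n.
have [x xP] : {x : 'I_n -> T & forall s, f (x s) = s}.
  apply: (boolp.choice (P := fun (s : 'I_n) t => f t = s)) => s.
  have [t _ ft] := f_surj s (ltn_ord s).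
  by exists t.
exists x; split.
  by move=> s t e; apply/val_inj; rewrite /= -!xP e.
move=> t; have ft : f t < n by apply: (f_fun t).
by exists (Ordinal ft); apply: f_inj; rewrite ?classical_sets.inE ?xP.
Qed.

Lemma embedding_permutation (k : nat) (A M : structure 'I_k) (f : A -> M) :
  permutation_structure M -> embedding f -> permutation_structure A.
Proof.
move=> Mperm [f_inj f_rel] i; split.
- by move=> x /f_rel /(lin_irr (Mperm i)).
- by move=> x y z /f_rel xy /f_rel yz; apply/f_rel/(lin_trans (Mperm i) xy).
- move=> x y xy; have /(lin_total (Mperm i)) : f x <> f y by move/f_inj.
  by case=> /f_rel; [left|right].
Qed.

(** Points are embedded one at a time; the position of the last one among the others cuts out a box
    in [M]. *)
Lemma embed_finite (k : nat) (A M : structure 'I_k.+1) n (x : 'I_n -> A) :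
  permutation_structure M -> (forall m, one_point_extension M m) ->
  permutation_structure A -> injective x ->
  exists e : 'I_n -> M, forall i s t, srel i (e s) (e t) <-> srel i (x s) (x t).
Proof.
move=> Mperm EP Aperm; elim: n x => [|n IH] x x_inj.
  have f0 : 'I_0 -> M by case.
  by exists f0 => i [].
have [e eP] := IH (x \o lift ord_max) (inj_comp x_inj (@lift_inj _ _)).
have [|||y yP] := EP n 'I_n e (finset.setTfor _)
  (fun i t => `[< srel i (x (lift ord_max t)) (x ord_max) >]).
- by rewrite cardsT card_ord.
- move=> s t _ _ est; apply: contrapT => /eqP st.
  have : x (lift ord_max s) <> x (lift ord_max t).
    by move/x_inj/lift_inj/eqP; apply/negP.
  by move/(lin_total (Aperm ord0)) => [] /eP; rewrite est => /(lin_irr (Mperm _)).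
- move=> i s t _ _ /eP st /asboolP ty; apply/asboolP.
  exact: (lin_trans (Aperm i) st).
have xlt i t : srel i (e t) y <-> srel i (x (lift ord_max t)) (x ord_max).
  have := yP i t (finset.in_setT _); case: asboolP => //= nt yt; split => // ty.
  by case: (lin_asym (Mperm i) yt).
have xgt i t : srel i y (e t) <-> srel i (x ord_max) (x (lift ord_max t)).
  have := yP i t (finset.in_setT _); case: asboolP => //= nt yt; split => // ty.
  - by case: (lin_asym (Mperm i) yt).
  - by case: (lin_asym (Aperm i) nt).
  - apply: (lin_notr (Aperm i)) nt => /x_inj/eqP; apply/negP.
    by rewrite eq_sym neq_lift.
exists (fun s => if unlift ord_max s is Some t then e t else y) => i s t.
case: (unliftP ord_max s) => [s'|] ->; case: (unliftP ord_max t) => [t'|] -> //.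
by split=> [/(lin_irr (Mperm i))|/(lin_irr (Aperm i))].
Qed.

Lemma generic_of_extension (k : nat) (M : structure 'I_k.+1) :
  countable [set: M]%classic -> permutation_structure M -> ultrahomogeneous M ->
  (forall m, one_point_extension M m) -> generic_permutation_structure M.
Proof.
move=> Mcnt Mperm Mhom EP; split=> // A; split=> [[finA [f f_emb]]|[finA Aperm]].
  by split=> //; apply: embedding_permutation f_emb.
split=> //; have [n [x [x_inj x_surj]]] := finite_enum finA.
have [e eP] := embed_finite Mperm EP Aperm x_inj.
have [r rP] : {r : A -> 'I_n & forall t, x (r t) = t}.
  exact: (boolp.choice (P := fun t s => x s = t)).
have e_rel i s t : srel i s t <-> srel i (e (r s)) (e (r t)).
  by rewrite eP !rP.
exists (e \o r); split=> // s t /= est; apply: contrapT.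
by move/(lin_total (Aperm ord0)) => [] /e_rel; rewrite est => /(lin_irr (Mperm _)).
Qed.

(** * Passing to some of the orders *)

(** Every order is a retained one or the reverse of one, so a partial isomorphism of the reduct is
    one of [M]. *)
Lemma ultrahomogeneous_reduct (I J : Type) (f : J -> I) (M : structure I) :
  (forall i, exists j, (forall x y : M, srel i x y <-> srel (f j) x y) \/
     (forall x y : M, srel i x y <-> opp_rel (srel (s := M) (f j)) x y)) ->
  ultrahomogeneous M -> ultrahomogeneous (reduct f M).
Proof.
move=> cov Mhom A B h finA finB [h_bij h_rel].
have [|g [[g_bij g_rel] gh]] := Mhom A B h finA finB.
  split=> // i x y xA yA; have [j [] ij] := cov i; rewrite !ij.
    exact: (h_rel j).
  exact: (h_rel j).
by exists g; split=> //; split=> // j x y; apply: g_rel.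
Qed.

Fixpoint formula_map (I J : Type) (f : J -> I) n (phi : formula J n) : formula I n :=
  match phi with
  | Eq _ s t => Eq I s t
  | Rel _ j s t => Rel (f j) s t
  | Not _ p => Not (formula_map f p)
  | And _ p q => And (formula_map f p) (formula_map f q)
  | Exists _ p => Exists (formula_map f p)
  end.

Lemma sat_formula_map (I J : Type) (f : J -> I) (M : structure I) n
    (phi : formula J n) (v : n.-tuple M) :
  sat (M := M) (formula_map f phi) v <-> sat (M := reduct f M) phi v.
Proof.
elim: phi v => //= {n} [n p IHp|n p IHp q IHq|n p IHp] v.
- by rewrite IHp.
- by rewrite IHp IHq.
- by split=> [] [a /IHp pa]; exists a.
Qed.

Lemma primitive_reduct (I J : Type) (f : J -> I) (M : structure I) :
  primitive M -> primitive (reduct f M).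
Proof.
move=> Mprim E eqE [phi phiP]; apply: Mprim => //.
by exists (formula_map f phi) => x y; rewrite phiP sat_formula_map.
Qed.

(** * Closure properties of definable relations *)

Section Definable.
Variables (k : nat) (M : structure 'I_k).

Lemma definable_eq : definable_rel (M := M) eq.
Proof. by exists (Eq _ ord0 (lift ord0 ord0)) => x y. Qed.

Lemma definable_srel i : definable_rel (M := M) (srel i).
Proof. by exists (Rel i ord0 (lift ord0 ord0)) => x y. Qed.

Lemma definable_not E : definable_rel (M := M) E ->
  definable_rel (M := M) (fun x y => ~ E x y).
Proof. by move=> [p pP]; exists (Not p) => x y; rewrite pP. Qed.

Lemma definable_and E F : definable_rel (M := M) E -> definable_rel (M := M) F ->
  definable_rel (M := M) (fun x y => E x y /\ F x y).
Proof. by move=> [p pP] [q qP]; exists (And p q) => x y; rewrite pP qP. Qed.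

Lemma definable_ext E F : (forall x y, E x y <-> F x y) ->
  definable_rel (M := M) E -> definable_rel (M := M) F.
Proof. by move=> EF [p pP]; exists p => x y; rewrite -EF. Qed.

Lemma definable_or E F : definable_rel (M := M) E -> definable_rel (M := M) F ->
  definable_rel (M := M) (fun x y => E x y \/ F x y).
Proof.
move=> dE dF; apply: (definable_ext (E := fun x y => ~ (~ E x y /\ ~ F x y))).
  by move=> x y; rewrite not_andP !notK.
by apply/definable_not/definable_and; apply: definable_not.
Qed.

End Definable.

(** * Finite patterns, amalgams and the checker *)

(* A vertex is the list of its coordinates, one for each order; a pattern is a
   finite set of vertices, compared coordinatewise. *)
Notation vertex := (seq nat).
Notation pattern := (seq (seq nat)).

Fixpoint sublists (T : Type) (s : seq T) : seq (seq T) :=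
  if s is a :: s' then let l := sublists s' in [seq a :: t | t <- l] ++ l
  else [:: [::]].

Fixpoint choices (T : Type) (L : seq (seq T)) : seq (seq T) :=
  if L is l :: L' then [seq a :: s | a <- l, s <- choices L'] else [:: [::]].

Lemma mem_sublists (T : eqType) (s t : seq T) :
  t \in sublists s -> {subset t <= s}.
Proof.
elim: s t => [|a s IH] t /=; first by rewrite inE => /eqP ->.
rewrite mem_cat => /orP [/mapP [u /IH us ->]|/IH ts] b.
  by rewrite !inE => /orP [->//|/us ->]; rewrite orbT.
by move/ts; rewrite inE => ->; rewrite orbT.
Qed.

Lemma mem_choices (T : eqType) (x0 : T) (L : seq (seq T)) s :
  size s = size L -> (forall i, i < size L -> nth x0 s i \in nth [::] L i) ->
  s \in choices L.
Proof.
elim: L s => [|l L IH] [|a s] //= [sz] H.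
apply/allpairsPdep; exists a, s; split=> //; first exact: (H 0).
by apply: IH => // i ltiL; apply: (H i.+1).
Qed.

(* Short-circuiting variants of [all] and [has]: the virtual machine evaluates
   both arguments of [&&] and [||]. *)
Fixpoint lall (T : Type) (t : pred T) (s : seq T) :=
  if s is a :: s' then if t a then lall t s' else false else true.

Fixpoint lhas (T : Type) (t : pred T) (s : seq T) :=
  if s is a :: s' then if t a then true else lhas t s' else false.

Lemma lallE (T : Type) (t : pred T) s : lall t s = all t s.
Proof. by elim: s => //= a s ->. Qed.

Lemma lhasE (T : Type) (t : pred T) s : lhas t s = has t s.
Proof. by elim: s => //= a s ->. Qed.

Section Patterns.
Variable k : nat.
Implicit Types (a b : vertex) (p q : pattern).

Definition by_first a b := head 0 a <= head 0 b.
Definition psort p := sort by_first p.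

(** Vertices are matched by position: for lists sorted along the first order no other matching can
    preserve that order. *)
Definition iso p q :=
  if size p == size q then
    lall (fun u => lall (fun v => lall (fun i =>
      (nth 0 u.1 i < nth 0 v.1 i) == (nth 0 u.2 i < nth 0 v.2 i)) (iota 0 k))
      (zip p q)) (zip p q)
  else false.

Definition contains q p := lhas (iso p) (sublists q).

(** The vertices are numbered along the first order, whose column is therefore left out of [cols].
    The same normal form gives [all_patterns] one pattern for each isomorphism type. *)
Definition pat (cols : seq (seq nat)) : pattern :=
  let n := size (head [::] cols) in
  [seq [seq nth 0 c s | c <- iota 0 n :: cols] | s <- iota 0 n].

Definition all_patterns n : seq pattern :=
  [seq [seq [seq nth 0 c s | c <- iota 0 n :: cols] | s <- iota 0 n]
     | cols <- choices (nseq k.-1 (permutations (iota 0 n)))].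

(** A vertex of [q] separates [u] from [v], so that transitivity fixes their order in every amalgam
    over [q]. *)
Definition gap q u v i :=
  lhas (fun a => (nth 0 u i < nth 0 a i < nth 0 v i) ||
                (nth 0 v i < nth 0 a i < nth 0 u i)) q.

Definition fresh q u :=
  lall (fun a => lall (fun i => nth 0 a i != nth 0 u i) (iota 0 k)) q.

(** Coordinates become odd; the even values leave room for a new vertex just below or just above
    each old one. *)
Definition spread a : vertex := mkseq (fun i => (nth 0 a i).*2.+1) k.

(* The ways to compare [y] with [x] in a common extension of [x :: q] and
   [y :: q]; [x] and [y] sit in the same gap of [q] for the undecided orders. *)
Definition placements q x y : seq vertex :=
  choices [seq if gap q x y i then [:: (nth 0 y i).*2.+1]
               else [:: (nth 0 x i).*2; (nth 0 x i).*2.+2] | i <- iota 0 k].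

Definition amalgams q x y : seq pattern :=
  [seq psort (y' :: [seq spread a | a <- x :: q]) | y' <- placements q x y].

Definition sign a b : seq bool := mkseq (fun i => nth 0 a i < nth 0 b i) k.

Definition in_type (U : seq (seq bool)) a b := (sign a b \in U) || (sign b a \in U).

Definition intransitive (U : seq (seq bool)) p :=
  lhas (fun a => lhas (fun b => lhas (fun c =>
    [&& a != b, b != c, a != c, in_type U a b, in_type U b c & ~~ in_type U a c])
    p) p) p.

Definition pair_test (t : vertex -> vertex -> bool) p :=
  if p is [:: a; b] then t a b else false.

(* A decision tree refuting a set of hypotheses on which patterns occur in a
   structure: [Branch p] distinguishes whether [p] occurs, and at a leaf, a
   disjunction of occurrences is found to fail. *)
Inductive tree :=
| Branch of pattern & tree & tree
| Amalg of pattern & nat & nat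
| Prim of seq (seq bool)
| Dist of nat & nat & bool.

Definition knows (K : seq pattern) p := lhas (fun q => contains q p) K.
Definition excluded (N : seq pattern) q := lhas (contains q) N.

Definition omit2 p i j :=
  [seq nth [::] p s | s <- iota 0 (size p) & (s != i) && (s != j)].

(** [K] collects patterns assumed to occur and [N] patterns assumed not to; occurrence passes to
    subpatterns, whence [knows] and [excluded]. *)
Fixpoint check (c : tree) (K N : seq pattern) : bool :=
  match c with
  | Branch p c1 c2 => if check c1 (p :: K) N then check c2 K (p :: N) else false
  | Amalg p i j =>
      let x := nth [::] p i in let y := nth [::] p j in let q := omit2 p i j in
      (* Separation in at least one order prevents an amalgam from identifying [x] with [y]. *)
      if [&& lhas (gap q x y) (iota 0 k), fresh q x & fresh q y] then
        if knows K (psort (x :: q)) then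
          if knows K (psort (y :: q)) then lall (excluded N) (amalgams q x y)
          else false
        else false
      else false
  | Prim U =>
      (* A known pair inside [U] and one outside make the relation given by [U] neither equality nor
         total, so it must fail to be transitive on some three-point pattern. *)
      if lhas (fun p => if pair_test (in_type U) p then knows K p else false)
           (all_patterns 2) then
        if lhas (fun p => if pair_test (fun a b => ~~ in_type U a b) p
                          then knows K p else false) (all_patterns 2) then
          lall (excluded N) [seq p <- all_patterns 3 | intransitive U p]
        else false
      else false
  | Dist i j s =>
      (* Distinct orders agree on some pair and disagree on another; for [i = j] only agreement can
         be claimed. *)
      if [&& i < k, j < k & (i != j) || s] then
        lall (excluded N) [seq p <- all_patterns 2 | pair_test (fun a b =>
           ((nth 0 a i < nth 0 b i) == (nth 0 a j < nth 0 b j)) == s) p]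
      else false
  end.

End Patterns.

(** * Occurrence of patterns in a structure *)

Section Occurrence.
Variables (k : nat) (M : structure 'I_k.+1).
Implicit Types (a b : vertex) (p q : pattern).

Definition realizes p (f : vertex -> M) :=
  forall i a b, a \in p -> b \in p ->
    srel i (f a) (f b) <-> nth 0 a i < nth 0 b i.

Definition occurs p := exists f, realizes p f.

Lemma occurs_sub p q : {subset p <= q} -> occurs q -> occurs p.
Proof.
by move=> pq [f fP]; exists f => i a b /pq aq /pq bq; apply: fP.
Qed.

Lemma occurs_psort p : occurs (psort p) <-> occurs p.
Proof. by split; apply: occurs_sub => a; rewrite mem_sort. Qed.

Lemma occurs_iso p q : iso k.+1 p q -> occurs q -> occurs p.
Proof.
rewrite /iso lallE; case: eqP => // sz /allP pq [f fP].
pose h a := nth [::] q (index a p).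
have hP a : a \in p -> h a \in q /\ (a, h a) \in zip p q.
  move=> ap; have lt : index a p < size p by rewrite index_mem.
  split; first by rewrite mem_nth -?sz.
  by rewrite -{1}(nth_index [::] ap) -nth_zip // mem_nth // size_zip -sz minnn.
exists (f \o h) => i a b /hP [haq az] /hP [hbq bz] /=.
rewrite fP //; have := pq _ az; rewrite lallE => /allP /(_ _ bz).
rewrite lallE => /allP /(_ (val i)).
by rewrite mem_iota /= ltn_ord => /(_ isT) /eqP ->.
Qed.

Lemma occurs_contains p q : contains k.+1 q p -> occurs q -> occurs p.
Proof.
rewrite /contains lhasE => /hasP [s /mem_sublists sq ps] qr.
exact: occurs_iso ps (occurs_sub sq qr).
Qed.

End Occurrence.

(** * Finite sets of points as enumerated patterns *)

Section Enumeration.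
Variables (k : nat) (A : structure 'I_k.+1).
Hypothesis Aperm : permutation_structure A.

Lemma perm_iotaP (n : nat) (r : 'I_n -> nat) :
  injective r -> (forall s, r s < n) -> perm_eq [seq r s | s <- enum 'I_n] (iota 0 n).
Proof.
move=> r_inj r_lt; have r_uniq : uniq [seq r s | s <- enum 'I_n].
  by rewrite map_inj_uniq ?enum_uniq.
apply: uniq_perm (iota_uniq _ _) _ => //.
have r_sub : {subset [seq r s | s <- enum 'I_n] <= iota 0 n}.
  by move=> u /mapP [s _ ->]; rewrite mem_iota; apply: r_lt.
have [|//] := uniq_min_size r_uniq r_sub.
by rewrite size_iota size_map size_enum_ord.
Qed.

(** The coordinates of a point are its ranks in the orders; sorting by the first rank turns the
    first column into [iota 0 n]. *)
Lemma exists_pattern n' (n := n'.+1) (x : 'I_n -> A) : injective x ->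
  exists2 p, p \in all_patterns k.+1 n &
    exists2 f, realizes p f & forall s, exists2 a, a \in p & f a = x s.
Proof.
move=> x_inj.
pose rank i s := #|[set t | `[< srel (s := A) i (x t) (x s) >]]%SET|.
have rank_lt i s t : srel i (x s) (x t) <-> rank i s < rank i t.
  have lt u v : srel i (x u) (x v) -> rank i u < rank i v.
    move=> uv; apply/proper_card/properP; split.
      apply/fintype.subsetP => w; rewrite !classical_sets.inE => wu.
      exact: (lin_trans (Aperm i) wu uv).
    exists u; rewrite !classical_sets.inE //; apply/negP; rewrite classical_sets.inE.
    exact: (lin_irr (Aperm i)).
  split; first exact: lt.
  move=> st; apply: contrapT => nst; have : x s <> x t.
    by move/x_inj => e; rewrite e ltnn in st.
  by move/(lin_total (Aperm i)) => [//|/lt]; rewrite ltnNge ltnW.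
have rank_inj i : injective (rank i).
  move=> s t e; apply: contrapT => st; have : x s <> x t by move/x_inj.
  by move/(lin_total (Aperm i)) => [] /rank_lt; rewrite e ltnn.
have rank_ltn i s : rank i s < n.
  rewrite -[X in _ < X](card_ord n) -cardsT; apply/proper_card/properP.
  split; first exact/finset.subsetT.
  exists s; rewrite !classical_sets.inE //; apply/negP.
  by rewrite classical_sets.inE; apply: (lin_irr (Aperm i)).
pose pt s := [seq rank i s | i <- enum 'I_k.+1].
have nth_pt (i : 'I_k.+1) s : nth 0 (pt s) i = rank i s.
  by rewrite (nth_map i) ?size_enum_ord // nth_ord_enum.
pose p := psort [seq pt s | s <- enum 'I_n].
have ptp s : pt s \in p by rewrite mem_sort map_f ?mem_enum.
have p_pt a : a \in p -> exists s, a = pt s.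
  by rewrite mem_sort => /mapP [s _ ->]; exists s.
have size_p : size p = n by rewrite size_sort size_map size_enum_ord.
have pt_inj : injective pt.
  by move=> s t e; apply: (@rank_inj ord0); rewrite -!nth_pt e.
exists p.
  pose col i := [seq nth 0 a i | a <- p].
  have size_col i : size (col i) = n by rewrite size_map.
  have col_perm (i : 'I_k.+1) : perm_eq (col i) (iota 0 n).
    apply: perm_trans (perm_iotaP (@rank_inj i) (rank_ltn i)).
    apply: perm_trans (perm_map _ _) _; first by rewrite perm_sort.
    by rewrite -map_comp; under eq_map => s do rewrite /= nth_pt.
  have col0 : col 0 = iota 0 n.
    apply: (sorted_eq leq_trans anti_leq) (col_perm ord0).
      rewrite sorted_map; under eq_sorted => a b do rewrite /= !nth0.
      by apply: sort_sorted => a b; apply: leq_total.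
    exact: iota_sorted.
  apply/mapP; exists [seq col i | i <- iota 1 k].
    apply: (@mem_choices _ [::]); rewrite ?size_map ?size_iota ?size_nseq //.
    move=> i ltik; rewrite nth_nseq ltik mem_permutations (nth_map 0) ?size_iota //.
    by rewrite nth_iota //; apply: (col_perm (Ordinal (ltik : i.+1 < k.+1))).
  apply: (@eq_from_nth _ [::]); first by rewrite size_map size_iota.
  move=> s; rewrite size_p => ltsn.
  rewrite (nth_map 0) ?size_iota // nth_iota // add0n -col0.
  have /p_pt [t pst] : nth [::] p s \in p by rewrite mem_nth ?size_p.
  have size_ps : size (nth [::] p s) = k.+1.
    by rewrite pst size_map size_enum_ord.
  apply: (@eq_from_nth _ 0); first by rewrite /= !size_map size_iota.
  move=> i; rewrite size_ps => ltik.
  have -> : (col 0 :: [seq col i | i <- iota 1 k]) = [seq col i | i <- iota 0 k.+1].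
    by [].
  rewrite -map_comp (nth_map 0) ?size_iota // nth_iota //=.
  by rewrite (nth_map [::]) ?size_p.
pose f a := x (odflt ord0 [pick s | pt s == a]).
have fP s : f (pt s) = x s.
  by rewrite /f; case: pickP => [t /eqP/pt_inj -> //|/(_ s)]; rewrite eqxx.
exists f.
  by move=> i _ _ /p_pt [s ->] /p_pt [t ->]; rewrite !fP !nth_pt.
by move=> s; exists (pt s).
Qed.

End Enumeration.

(** * Soundness of the checker *)

Section Soundness.
Variables (k : nat) (M : structure 'I_k.+1).
Hypothesis Mperm : permutation_structure M.
Hypothesis Mhom : ultrahomogeneous M.
Implicit Types (a b : vertex) (p q : pattern).

(** An automorphism moves the second copy of [q] onto the first. The new points [X] and [Y] are then
    compared by transitivity where [q] separates them; elsewhere their actual order in [M] selects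
    the placement. *)
Lemma occurs_amalgam q x y :
  lhas (gap q x y) (iota 0 k.+1) -> fresh k.+1 q x -> fresh k.+1 q y ->
  occurs M (x :: q) -> occurs M (y :: q) ->
  exists2 p, p \in amalgams k.+1 q x y & occurs M p.
Proof.
rewrite lhasE => gap_xy fx fy [f1 f1P] [f2 f2P].
have sub z a : a \in q -> a \in z :: q by rewrite inE => ->; rewrite orbT.
have [g [_ gh] gP] : exists2 g : M -> M, automorphism g &
    forall a, a \in q -> g (f2 a) = f1 a.
  apply: extend_seq => // i a b aq bq.
  apply: iff_trans (f2P i a b (sub _ _ aq) (sub _ _ bq)) _.
  by apply: iff_sym (f1P i a b _ _); apply: sub.
pose X := f1 x; pose Y := g (f2 y).
have Yl (i : 'I_k.+1) a : a \in q -> srel i (f1 a) Y <-> nth 0 a i < nth 0 y i.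
  move=> aq; rewrite -(gP _ aq); apply: iff_trans (iff_sym (gh i _ _)) _.
  by apply: f2P; rewrite ?mem_head //; apply: sub.
have Yr (i : 'I_k.+1) a : a \in q -> srel i Y (f1 a) <-> nth 0 y i < nth 0 a i.
  move=> aq; rewrite -(gP _ aq); apply: iff_trans (iff_sym (gh i _ _)) _.
  by apply: f2P; rewrite ?mem_head //; apply: sub.
have Xl (i : 'I_k.+1) a : a \in q -> srel i (f1 a) X <-> nth 0 a i < nth 0 x i.
  by move=> aq; apply: f1P; rewrite ?mem_head //; apply: sub.
have Xr (i : 'I_k.+1) a : a \in q -> srel i X (f1 a) <-> nth 0 x i < nth 0 a i.
  by move=> aq; apply: f1P; rewrite ?mem_head //; apply: sub.
have gapP (i : 'I_k.+1) : gap q x y i ->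
    (srel i X Y /\ nth 0 x i < nth 0 y i) \/ (srel i Y X /\ nth 0 y i < nth 0 x i).
  rewrite /gap lhasE => /hasP [a aq] /orP [] /andP [l1 l2]; [left|right].
    split; last exact: ltn_trans l2.
    by apply: (lin_trans (Mperm i) (y := f1 a)); [apply/Xr|apply/Yl].
  split; last exact: ltn_trans l2.
  by apply: (lin_trans (Mperm i) (y := f1 a)); [apply/Yr|apply/Xl].
have XY : X <> Y.
  move=> e; case/hasP: gap_xy => i; rewrite mem_iota add0n /= => ltik.
  by move=> /(gapP (Ordinal ltik)); rewrite e => -[] [] /(lin_irr (Mperm _)).
have freshP z (i : 'I_k.+1) a : fresh k.+1 q z -> a \in q -> nth 0 a i != nth 0 z i.
  rewrite /fresh lallE => /allP fz /fz; rewrite lallE => /allP; apply.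
  by rewrite mem_iota /=.
pose coord i := if gap q x y i then (nth 0 y i).*2.+1 else
  if `[< srel (s := M) (inord i) X Y >] then (nth 0 x i).*2.+2 else (nth 0 x i).*2.
pose y' : vertex := mkseq coord k.+1.
have nth_y' (i : 'I_k.+1) : nth 0 y' i = coord i by rewrite nth_mkseq.
pose q' := [seq spread k.+1 a | a <- x :: q].
have y'P : y' \in placements k.+1 q x y.
  apply: (@mem_choices _ 0); rewrite ?size_map ?size_iota // => i ltik.
  rewrite /y' nth_mkseq // (nth_map 0) ?size_iota // nth_iota // add0n /coord.
  case: gap; first exact: mem_head.
  by case: asbool; rewrite !in_cons eqxx ?orbT.
exists (psort (y' :: q')); first by apply/mapP; exists y'.
apply/occurs_psort.
(* On the spread vertices, [dec] undoes [spread]. *)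
pose dec b := nth [::] (x :: q) (index b q').
have decP b : b \in q' -> dec b \in x :: q /\ spread k.+1 (dec b) = b.
  move=> bq; have lt : index b q' < size (x :: q).
    by rewrite -(size_map (spread k.+1)) index_mem.
  by rewrite mem_nth // /dec -(nth_map _ [::]) // nth_index.
have nth_spread (i : 'I_k.+1) a : nth 0 (spread k.+1 a) i = (nth 0 a i).*2.+1.
  by rewrite nth_mkseq.
have Y_dec (i : 'I_k.+1) a : a \in x :: q ->
    (srel i Y (f1 a) <-> coord i < (nth 0 a i).*2.+1) /\
    (srel i (f1 a) Y <-> (nth 0 a i).*2.+1 < coord i).
  rewrite inE => /orP [/eqP ->|aq].
    rewrite /coord -/X; case: ifP => [/gapP [] [xy lt]|_].
    - split; split=> // h; [case: (lin_asym (Mperm i) xy h)|lia|lia].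
    - split; split=> // h; [lia|case: (lin_asym (Mperm i) xy h)|lia].
    rewrite inord_val; case: asboolP => xy; split; split=> // h; try lia.
    - by case: (lin_asym (Mperm i) xy h).
    - exact: (lin_notr (Mperm i) XY xy).
  rewrite Yl // Yr //; have := freshP _ i _ fx aq; have := freshP _ i _ fy aq.
  rewrite /coord; case: (boolP (gap q x y i)) => [_|]; last first.
    rewrite /gap lhasE => /hasPn /(_ a aq).
    by case: asbool => *; split; split; lia.
  by move=> _ _; split; split; lia.
exists (fun b => if b == y' then Y else f1 (dec b)) => i a b.
rewrite (in_cons y' q' a) (in_cons y' q' b).
case: (eqVneq a y') => [->|_] /=; case: (eqVneq b y') => [->|_] /=.
- by rewrite ltnn => _ _; split => // /(lin_irr (Mperm i)).
- move=> _ /decP [bq eb]; rewrite -{2}eb nth_y' nth_spread.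
  exact: (Y_dec i _ bq).1.
- move=> /decP [aq ea] _; rewrite -{2}ea nth_y' nth_spread.
  exact: (Y_dec i _ aq).2.
- move=> /decP [aq ea] /decP [bq eb]; rewrite -{2}ea -{2}eb !nth_spread f1P //.
  by rewrite ltnS ltn_double.
Qed.

(** For distinct [i] and [j], the case [s = true] says that the orders are not reverse to each
    other, and [s = false] that they are not equal. For [i = j] it says that [M] has two points. *)
Definition distinct_orders := forall (i j : 'I_k.+1) (s : bool), (i != j) || s ->
  exists x y : M, x <> y /\ (srel i x y <-> if s then srel j x y else srel j y x).

Hypothesis Mprim : primitive M.
Hypothesis Mdist : distinct_orders.

Definition type2 (x y : M) : seq bool :=
  mkseq (fun i => `[< srel (s := M) (inord i) x y >]) k.+1.

Lemma sign_type2 p f a b : realizes (M := M) p f -> a \in p -> b \in p ->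
  sign k.+1 a b = type2 (f a) (f b).
Proof.
move=> fP ap bp; apply: (@eq_from_nth _ false); rewrite !size_mkseq // => i ltik.
rewrite !nth_mkseq //; have := fP (Ordinal ltik) a b ap bp.
have -> : inord i = Ordinal ltik by apply: val_inj; rewrite /= inordK.
by move=> h; apply/idP/asboolP => /h.
Qed.

(** A disjunction over [U] of conjunctions over the orders; a list of the wrong length contributes
    the empty relation. *)
Lemma definable_type2 (U : seq (seq bool)) :
  definable_rel (M := M) (fun x y => type2 x y \in U).
Proof.
have dF : definable_rel (M := M) (fun x y => x = y /\ x <> y).
  by apply/definable_and/definable_not; apply: definable_eq.
elim: U => [|u U IH].
  by apply: definable_ext dF => x y; rewrite in_nil; split=> // -[].
suff du : definable_rel (M := M) (fun x y => type2 x y = u).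
  apply: definable_ext (definable_or du IH) => x y; rewrite inE.
  by split=> [[->|->]|/orP [/eqP|]]; rewrite ?eqxx ?orbT; [| |left|right].
have [su|su] := eqVneq (size u) k.+1; last first.
  apply: definable_ext dF => x y; split=> [[]//|e].
  by rewrite -e size_mkseq eqxx in su.
suff dn n : n <= k.+1 -> definable_rel (M := M)
    (fun x y => forall i : 'I_k.+1, i < n -> srel i x y <-> nth false u i).
  apply: definable_ext (dn _ (leqnn _)) => x y; split=> [h|<- i _].
    apply: (@eq_from_nth _ false); rewrite size_mkseq // => i ltik.
    rewrite nth_mkseq //; have := h (Ordinal ltik) ltik.
    have -> : inord i = Ordinal ltik by apply: val_inj; rewrite /= inordK.
    by move=> hi; apply/asboolP/idP => /hi.
  by rewrite nth_mkseq // inord_val; split=> [/asboolP|/asboolP].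
elim: n => [_|n IHn ltnk].
  by apply: definable_ext (definable_not dF) => x y; split=> // _ [].
pose i0 := Ordinal ltnk.
have d0 : definable_rel (M := M) (fun x y => srel i0 x y <-> nth false u n).
  case: (nth false u n).
    apply: definable_ext (definable_srel M i0) => x y.
    by split=> [h|[_ h]]; [split|apply: h].
  apply: definable_ext (definable_not (definable_srel M i0)) => x y.
  by split=> [nxy|h]; [split|move/h].
apply: definable_ext (definable_and (IHn (ltnW ltnk)) d0) => x y.
split=> [[h h0] i|h]; last by split=> [i /ltnW/h//|]; apply: (h i0 (ltnSn n)).
rewrite ltnS leq_eqVlt => /orP [/eqP e|]; last exact: h.
have -> : i = i0 by apply: val_inj.
exact: h0.
Qed.

Lemma two_point_pattern (x y : M) : x <> y -> exists2 p, p \in all_patterns k.+1 2 &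
  exists2 f, realizes (M := M) p f & exists a b, p = [:: a; b] /\
    ((f a = x /\ f b = y) \/ (f a = y /\ f b = x)).
Proof.
move=> xy; pose v (i : 'I_2) := if i == ord0 then x else y.
have v_inj : injective v.
  by move=> [[|[]]] // ? [[|[]]] // ?; rewrite /v /= => e; apply: val_inj => //=;
    case: xy.
have [p pP [f fP fv]] := exists_pattern Mperm v_inj.
have [a ap fa] := fv ord0; have [b bp fb] := fv (lift ord0 ord0).
rewrite /v /= in fa fb.
exists p => //; exists f => //.
have : size p = 2.
  by case/mapP: pP => cols _ ->; rewrite size_map size_iota.
case: p ap bp {pP fP fv} => [|c [|d []]] //= ap bp _; exists c, d; split=> //.
move: ap bp; rewrite !inE => /orP [] /eqP ea /orP [] /eqP eb; subst a b.
- by case: xy; rewrite -fa -fb.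
- by left.
- by right.
- by case: xy; rewrite -fa -fb.
Qed.

Lemma type2_sym (x y : M) : x <> y -> type2 y x = map negb (type2 x y).
Proof.
move=> xy; rewrite -map_comp; apply: eq_map => i /=; apply/asboolP/idP.
  by move=> yx; apply/asboolPn => /(lin_asym (Mperm _) yx).
by move=> /asboolPn; apply: (lin_notr (Mperm _)).
Qed.

Lemma pair_testP t p : p \in all_patterns k.+1 2 -> pair_test t p ->
  exists a b, [/\ t a b, a \in p, b \in p & nth 0 a 0 < nth 0 b 0].
Proof.
case/mapP => cols _ -> /= tab.
set a := [seq nth 0 c 0 | c <- _] in tab; set b := [seq nth 0 c 1 | c <- _] in tab.
by exists (0 :: a), (1 :: b); rewrite !inE !eqxx orbT.
Qed.

Lemma knows_occurs K p : (forall q, q \in K -> occurs M q) ->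
  knows k.+1 K p -> occurs M p.
Proof. by rewrite /knows lhasE => KM /hasP [q /KM qM /occurs_contains]; apply. Qed.

Lemma excluded_occurs N p : (forall q, q \in N -> ~ occurs M q) ->
  excluded k.+1 N p -> ~ occurs M p.
Proof.
rewrite /excluded lhasE => NM /hasP [q /NM qM pq] pM.
exact/qM/(occurs_contains pq).
Qed.

Lemma check_sound c K N : check k.+1 c K N ->
  (forall q, q \in K -> occurs M q) -> (forall q, q \in N -> ~ occurs M q) -> False.
Proof.
elim: c K N => [p c1 IH1 c2 IH2|p i j|U|i j s] K N /= chk KM NM.
- case: ifP chk => // chk1 chk2; have [pM|pM] := pselect (occurs M p).
    by apply: IH1 chk1 _ NM => q; rewrite inE => /orP [/eqP ->|/KM].
  by apply: IH2 chk2 KM _ => q; rewrite inE => /orP [/eqP ->|/NM].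
- case: ifP chk => // /and3P [gp fx fy]; case: ifP => // kx; case: ifP => // ky.
  rewrite lallE => /allP ex.
  have [||p' /ex/(excluded_occurs NM) + p'M] := occurs_amalgam gp fx fy; last exact.
    exact/occurs_psort/(knows_occurs KM).
  exact/occurs_psort/(knows_occurs KM).
- move: chk; rewrite !lhasE lallE; case: hasP => // -[u u2]; case: ifP => // uU ku.
  case: hasP => // -[w w2]; case: ifP => // wU kw /allP ex.
  pose E x y := x = y \/ (type2 x y \in U \/ type2 y x \in U).
  have in_typeE p f a b : realizes (M := M) p f -> a \in p -> b \in p ->
      in_type k.+1 U a b <-> type2 (f a) (f b) \in U \/ type2 (f b) (f a) \in U.
    move=> fP ap bp; rewrite /in_type !(sign_type2 fP) //.
    by split=> /orP.
  have dE : definable_rel (M := M) E.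
    (* Reversing a pair of distinct points negates its type, so the symmetrized relation is again a
       union of types. *)
    pose U' := U ++ [seq map negb u | u <- U].
    apply: definable_ext (definable_or (definable_eq M) (definable_type2 U')).
    move=> x y; have [->|xy] := pselect (x = y); first by split=> _; left.
    rewrite /E (type2_sym xy) mem_cat; split=> [[//|/orP h]|[//|h]]; right.
      case: h => [|/mapP [u' u'U ->]]; [by left|right].
      by rewrite mapK // => -[].
    apply/orP; case: h => [|hU]; [by left|right].
    by apply/mapP; exists (map negb (type2 x y)); rewrite ?mapK // => -[].
  have eqE : Equivalence E.
    split.
    + by move=> x; left.
    + by move=> x y [->|[?|?]]; [left|right; right|right; left].
    + move=> x y z xy yz; apply: contrapT => xz.
      have nxy : x <> y by move=> e; rewrite e in xz.
      have nyz : y <> z by move=> e; rewrite -e in xz.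
      have nxz : x <> z by move=> e; apply: xz; left.
      (* A failure of transitivity would realize one of the excluded three-point patterns. *)
      pose v (i : 'I_3) := [eta nth x [:: x; y; z]] i.
      have v_inj : injective v.
        move=> [[|[|[]]]] // ? [[|[|[]]]] // ?; rewrite /v /= => e; apply: val_inj => //=;
          exfalso; congruence.
      have [p pP [f fP fv]] := exists_pattern Mperm v_inj.
      have [a ap fa] := fv ord0; have [b bp fb] := fv (lift ord0 ord0).
      have [c cp fc] := fv ord_max; rewrite /v /= in fa fb fc.
      have pM : occurs M p by exists f.
      apply: (excluded_occurs NM) pM; apply: ex; rewrite mem_filter pP andbT.
      rewrite /intransitive !lhasE; apply/hasP; exists a => //.
      rewrite !lhasE; apply/hasP; exists b => //.
      rewrite !lhasE; apply/hasP; exists c => //.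
      apply/and5P; split.
      * by apply/eqP => e; apply: nxy; rewrite -fa -fb e.
      * by apply/eqP => e; apply: nyz; rewrite -fb -fc e.
      * by apply/eqP => e; apply: nxz; rewrite -fa -fc e.
      * by apply/(in_typeE _ _ _ _ fP ap bp); rewrite fa fb; case: xy.
      * apply/andP; split.
          by apply/(in_typeE _ _ _ _ fP bp cp); rewrite fb fc; case: yz.
        apply/negP => /(in_typeE _ _ _ _ fP ap cp); rewrite fa fc => h.
        by apply: xz; right.
  (* The known pair inside [U] refutes equality, and the one outside refutes totality. *)
  have [Eeq|Eall] := Mprim eqE dE.
    have [f fP] := knows_occurs KM ku; have [a [b [ab au bu lt]]] := pair_testP u2 uU.
    have e : f a = f b by apply/Eeq; right; apply/(in_typeE _ _ _ _ fP au bu).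
    by move/(fP ord0 _ _ au bu): lt; rewrite e => /(lin_irr (Mperm _)).
  have [f fP] := knows_occurs KM kw; have [a [b [ab au bu lt]]] := pair_testP w2 wU.
  have [e|] := Eall (f a) (f b); last by move/(in_typeE _ _ _ _ fP au bu); apply/negP.
  by move/(fP ord0 _ _ au bu): lt; rewrite e => /(lin_irr (Mperm _)).
- case: ifP chk => // /and3P [ltik ltjk ns]; rewrite lallE => /allP ex.
  have [x [y [xy ijs]]] := @Mdist (Ordinal ltik) (Ordinal ltjk) s ns.
  have [p p2 [f fP [a [b [ep fab]]]]] := two_point_pattern xy.
  have pM : occurs M p by exists f.
  apply: (excluded_occurs NM) pM; apply: ex; rewrite mem_filter p2 andbT ep /=.
  have [ap bp] : a \in p /\ b \in p by rewrite ep !inE !eqxx orbT.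
  have fi := fP (Ordinal ltik) a b ap bp; have fj := fP (Ordinal ltjk) a b ap bp.
  have tot l u v : u <> v -> srel (s := M) l u v <-> ~ srel l v u.
    move=> uv; split; first exact: (lin_asym (Mperm l)).
    by apply: (lin_notr (Mperm l)) => e; apply: uv.
  have {ijs} ab : srel (Ordinal ltik) (f a) (f b) <->
      if s then srel (Ordinal ltjk) (f a) (f b) else ~ srel (Ordinal ltjk) (f a) (f b).
    have [ti tj] := (tot (Ordinal ltik) _ _ xy, tot (Ordinal ltjk) _ _ xy).
    have [ti' tj'] :=
      (tot (Ordinal ltik) _ _ (nesym xy), tot (Ordinal ltjk) _ _ (nesym xy)).
    by case: fab => -[-> ->]; case: (s) ijs; tauto.
  move: fi fj ab {ns}; rewrite /=; have [yes no] : true /\ ~ false by [].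
  by case: (nth 0 a i < _); case: (nth 0 a j < _); case: (s) => //=; tauto.
Qed.

End Soundness.

(** * Deriving the occurrence of patterns by computation *)

Section Derivation.
Variable k : nat.
Implicit Types (p q : pattern).

Definition omit p i := [seq nth [::] p s | s <- iota 0 (size p) & s != i].

Definition index_pairs n :=
  [seq (i, j) | i <- iota 0 n, j <- iota i.+1 (n - i.+1)].

(** The two vertices are separated in every order, which makes [p] the only amalgam of the two
    patterns obtained by omitting one of them. *)
Definition forced p ij :=
  lall (gap (omit2 p ij.1 ij.2) (nth [::] p ij.1) (nth [::] p ij.2)) (iota 0 k).

Definition direct p :=
  [seq Amalg p ij.1 ij.2 | ij <- index_pairs (size p) & forced p ij].

(** Coordinates refer to [p] after [spread]. Where nothing separates the two vertices, the new one
    takes the midpoint of [2a + 1] and [2b + 1], that is [a + b + 1]; elsewhere all the free even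
    positions are tried. *)
Definition separators p ij : seq vertex :=
  choices [seq if gap p (nth [::] p ij.1) (nth [::] p ij.2) c
               then [seq s.*2 | s <- iota 0 (size p).+1]
               else [:: (nth 0 (nth [::] p ij.1) c
                         + nth 0 (nth [::] p ij.2) c).+1]
          | c <- iota 0 k].

(* Two vertices of [p] that are adjacent in some orders get separated by an
   auxiliary vertex, with which [p] is a forced amalgam of two patterns that
   are forced amalgams themselves. *)
Definition assisted K p :=
  lhas (fun ij => lhas (fun z =>
    let q := z :: [seq spread k a | a <- p] in
    (* Positions are shifted by one because [z] is put in front. *)
    let qi := psort (omit q ij.1.+1) in let qj := psort (omit q ij.2.+1) in
    lhas (fun ti => lhas (fun tj =>
      check k (Branch qj (Branch qi (Amalg q ij.1.+1 ij.2.+1) ti) tj) K [:: p])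
    (direct qj)) (direct qi)) (separators p ij)) (index_pairs (size p)).

(* Permuting the orders according to [g.1] and reversing some of them
   according to [g.2]; [9] bounds all coordinates in use. *)
Section Symmetry.
Variable g : seq nat * seq bool.

Definition move_vertex (a : vertex) : vertex :=
  mkseq (fun i => let c := nth 0 a (nth 0 g.1 i) in
                  if nth false g.2 i then 9 - c else c) k.

Definition move_pattern p := psort [seq move_vertex a | a <- p].

(** The old order [i] is found at position [index i g.1]. Reversing an order negates its entry in
    each type and exchanges agreement with disagreement; vertices are located afresh since sorting
    may renumber them. *)
Fixpoint move_tree (t : tree) : tree :=
  match t with
  | Branch p t1 t2 => Branch (move_pattern p) (move_tree t1) (move_tree t2)
  | Amalg p i j =>
      let q := move_pattern p in
      Amalg q (index (move_vertex (nth [::] p i)) q)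
              (index (move_vertex (nth [::] p j)) q)
  | Prim U =>
      Prim [seq mkseq (fun i => nth false g.2 i (+) nth false u (nth 0 g.1 i)) k
           | u <- U]
  | Dist i j s =>
      let i' := index i g.1 in let j' := index j g.1 in
      Dist i' j' (s (+) nth false g.2 i' (+) nth false g.2 j')
  end.

End Symmetry.

Definition symmetries : seq (seq nat * seq bool) :=
  [seq (s, e) | s <- permutations (iota 0 k),
                e <- choices (nseq k [:: false; true])].

(* Each tree comes with the pattern whose absence it refutes. *)
Definition derivable (trees : seq (pattern * tree)) K p :=
  if knows k K p then true
  else if lhas (fun t => check k t K [:: p]) (direct p) then true
  else if assisted K p then true
  else lhas (fun g => lhas (fun c =>
    if iso k (move_pattern g c.1) p then check k (move_tree g c.2) K [:: p]
    else false) trees) symmetries.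

(** Three points take two rounds: patterns derived from pairs alone serve as known patterns for
    deriving the others. *)
Definition derivable_upto4 (trees : seq (pattern * tree)) :=
  if lall (derivable trees [::]) (all_patterns k 2) then
    let K :=
      [seq p <- all_patterns k 3 | derivable trees (all_patterns k 2) p] in
    if lall (derivable trees K) (all_patterns k 3) then
      lall (derivable trees (all_patterns k 3)) (all_patterns k 4)
    else false
  else false.

End Derivation.

(* The trees below were found by computer search. *)
Definition planar_triangle_tree : pattern * tree :=
  (pat [:: [:: 0; 2; 1]],
  Branch (pat [:: [:: 2; 0; 1]]) (Branch (pat [:: [:: 1; 0; 2]]) (Branch (pat
  [:: [:: 1; 2; 0]]) (Branch (pat [:: [:: 2; 1; 3; 0]]) (Branch (pat [:: [::
  3; 1; 0; 2]]) (Amalg (pat [:: [:: 3; 1; 4; 0; 2]]) 2 4) (Amalg (pat [:: [::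
  3; 1; 0; 2]]) 0 2)) (Amalg (pat [:: [:: 2; 1; 3; 0]]) 0 3)) (Amalg (pat [::
  [:: 0; 2; 1]]) 0 2)) (Prim [:: [:: true; true]])) (Amalg (pat [:: [:: 0; 2;
  1]]) 0 1)).

(** The pair on which three orders agree: in its absence, the [Dist] leaves force the three other
    types of pairs. Reversing orders carries this tree to those types. *)
Definition two_types_tree : pattern * tree :=
  (pat [:: [:: 0; 1]; [:: 0; 1]],
  Branch (pat [:: [:: 1; 0]; [:: 1; 0]]) (Branch (pat [:: [:: 1; 0]; [:: 0;
  1]]) (Branch (pat [:: [:: 0; 1]; [:: 1; 0]]) (Branch (pat [:: [:: 2; 1; 0];
  [:: 0; 1; 2]]) (Branch (pat [:: [:: 3; 1; 4; 0; 2]; [:: 1; 3; 0; 4; 2]])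
  (Branch (pat [:: [:: 0; 3; 2; 1]; [:: 3; 2; 0; 1]]) (Amalg (pat [:: [:: 2;
  0; 4; 3; 1]; [:: 1; 4; 3; 0; 2]]) 0 2) (Branch (pat [:: [:: 2; 1; 0; 3]; [::
  2; 3; 1; 0]]) (Amalg (pat [:: [:: 3; 1; 0; 4; 2]; [:: 2; 4; 1; 0; 3]]) 2 4)
  (Branch (pat [:: [:: 0; 2; 3; 1]; [:: 3; 1; 0; 2]]) (Branch (pat [:: [:: 3;
  2; 0; 1]; [:: 0; 3; 2; 1]]) (Amalg (pat [:: [:: 1; 4; 3; 0; 2]; [:: 2; 0; 4;
  3; 1]]) 0 2) (Branch (pat [:: [:: 1; 2; 0; 3]; [:: 3; 2; 1; 0]]) (Amalg (pat
  [:: [:: 1; 3; 0; 4; 2]; [:: 4; 2; 1; 0; 3]]) 2 4) (Branch (pat [:: [:: 1; 0;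
  2]; [:: 2; 1; 0]]) (Branch (pat [:: [:: 2; 1; 0]; [:: 1; 2; 0]]) (Amalg (pat
  [:: [:: 2; 1; 0; 3]; [:: 2; 3; 1; 0]]) 1 3) (Branch (pat [:: [:: 2; 1; 0];
  [:: 0; 2; 1]]) (Branch (pat [:: [:: 2; 0; 1]; [:: 2; 1; 0]]) (Amalg (pat [::
  [:: 3; 2; 0; 1]; [:: 0; 3; 2; 1]]) 0 2) (Branch (pat [:: [:: 1; 2; 0]; [::
  2; 1; 0]]) (Amalg (pat [:: [:: 1; 2; 0; 3]; [:: 3; 2; 1; 0]]) 0 3) (Branch
  (pat [:: [:: 0; 2; 1]; [:: 2; 1; 0]]) (Branch (pat [:: [:: 2; 1; 0]; [:: 2;
  0; 1]]) (Amalg (pat [:: [:: 0; 3; 2; 1]; [:: 3; 2; 0; 1]]) 0 2) (Prim [::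
  [:: true; false; false]])) (Amalg (pat [:: [:: 1; 2; 0]; [:: 2; 1; 0]]) 0
  2)))) (Amalg (pat [:: [:: 2; 1; 0]; [:: 1; 2; 0]]) 0 2))) (Branch (pat [::
  [:: 2; 0; 1]; [:: 2; 1; 0]]) (Branch (pat [:: [:: 1; 2; 0]; [:: 2; 0; 1]])
  (Amalg (pat [:: [:: 1; 2; 0; 3]; [:: 3; 1; 2; 0]]) 0 3) (Branch (pat [:: [::
  2; 1; 0]; [:: 0; 2; 1]]) (Amalg (pat [:: [:: 3; 2; 0; 1]; [:: 0; 3; 2; 1]])
  0 2) (Branch (pat [:: [:: 2; 1; 0]; [:: 2; 0; 1]]) (Branch (pat [:: [:: 2;
  1; 0]; [:: 1; 2; 0]]) (Branch (pat [:: [:: 0; 2; 1]; [:: 2; 1; 0]]) (Amalg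
  (pat [:: [:: 0; 3; 2; 1]; [:: 3; 2; 0; 1]]) 0 2) (Branch (pat [:: [:: 2; 0;
  1]; [:: 1; 2; 0]]) (Amalg (pat [:: [:: 0; 3; 1; 2]; [:: 3; 1; 2; 0]]) 0 3)
  (Branch (pat [:: [:: 2; 1; 0]; [:: 1; 0; 2]]) (Branch (pat [:: [:: 3; 2; 1;
  0]; [:: 3; 1; 0; 2]]) (Branch (pat [:: [:: 3; 2; 1; 0]; [:: 2; 1; 3; 0]])
  (Amalg (pat [:: [:: 4; 3; 2; 1; 0]; [:: 3; 1; 4; 0; 2]]) 2 4) (Amalg (pat
  [:: [:: 3; 2; 1; 0]; [:: 2; 1; 3; 0]]) 1 3)) (Amalg (pat [:: [:: 2; 3; 1;
  0]; [:: 3; 1; 0; 2]]) 0 1)) (Prim [:: [:: true; true; true]; [:: true; true;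
  false]; [:: true; false; true]])))) (Amalg (pat [:: [:: 2; 1; 0]; [:: 1; 2;
  0]]) 0 2)) (Amalg (pat [:: [:: 1; 2; 0]; [:: 2; 0; 1]]) 0 1)))) (Amalg (pat
  [:: [:: 2; 0; 1]; [:: 2; 1; 0]]) 0 2))))) (Amalg (pat [:: [:: 0; 2; 3; 1];
  [:: 3; 1; 0; 2]]) 0 2)))) (Branch (pat [:: [:: 1; 2; 0; 3]; [:: 2; 1; 3;
  0]]) (Branch (pat [:: [:: 2; 1; 3; 0]; [:: 1; 2; 0; 3]]) (Branch (pat [::
  [:: 3; 1; 0; 2]; [:: 0; 2; 3; 1]]) (Amalg (pat [:: [:: 3; 1; 4; 0; 2]; [::
  1; 3; 0; 4; 2]]) 2 4) (Branch (pat [:: [:: 2; 0; 1]; [:: 0; 2; 1]]) (Amalg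
  (pat [:: [:: 3; 1; 0; 2]; [:: 0; 2; 3; 1]]) 0 2) (Branch (pat [:: [:: 0; 2;
  3; 1]; [:: 3; 1; 0; 2]]) (Amalg (pat [:: [:: 1; 3; 0; 4; 2]; [:: 3; 1; 4; 0;
  2]]) 2 4) (Branch (pat [:: [:: 0; 2; 1]; [:: 2; 0; 1]]) (Amalg (pat [:: [::
  0; 2; 3; 1]; [:: 3; 1; 0; 2]]) 0 2) (Amalg (pat [:: [:: 2; 0; 1]; [:: 0; 2;
  1]]) 0 1))))) (Amalg (pat [:: [:: 2; 1; 3; 0]; [:: 1; 2; 0; 3]]) 0 3))
  (Branch (pat [:: [:: 0; 2; 3; 1]; [:: 3; 1; 0; 2]]) (Branch (pat [:: [:: 1;
  0; 2]; [:: 1; 2; 0]]) (Amalg (pat [:: [:: 1; 2; 0; 3]; [:: 2; 1; 3; 0]]) 0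
  3) (Branch (pat [:: [:: 1; 3; 2; 0]; [:: 2; 0; 1; 3]]) (Branch (pat [:: [::
  3; 0; 2; 1]; [:: 0; 3; 1; 2]]) (Amalg (pat [:: [:: 2; 4; 0; 3; 1]; [:: 2; 0;
  4; 1; 3]]) 0 2) (Branch (pat [:: [:: 2; 0; 1]; [:: 0; 2; 1]]) (Amalg (pat
  [:: [:: 3; 0; 2; 1]; [:: 0; 3; 1; 2]]) 0 3) (Branch (pat [:: [:: 2; 0; 1];
  [:: 1; 2; 0]]) (Branch (pat [:: [:: 0; 3; 1; 2]; [:: 3; 1; 2; 0]]) (Branch
  (pat [:: [:: 2; 1; 0]; [:: 0; 2; 1]]) (Amalg (pat [:: [:: 3; 2; 0; 1]; [::
  0; 2; 3; 1]]) 0 2) (Branch (pat [:: [:: 1; 3; 2; 0]; [:: 2; 1; 0; 3]])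
  (Branch (pat [:: [:: 3; 2; 0; 1]; [:: 2; 1; 3; 0]]) (Branch (pat [:: [:: 2;
  1; 0]; [:: 1; 2; 0]]) (Branch (pat [:: [:: 1; 0; 2]; [:: 2; 1; 0]]) (Amalg
  (pat [:: [:: 2; 1; 0; 3]; [:: 2; 3; 1; 0]]) 1 3) (Branch (pat [:: [:: 3; 0;
  2; 1]; [:: 2; 3; 1; 0]]) (Amalg (pat [:: [:: 4; 1; 3; 0; 2]; [:: 2; 4; 1; 3;
  0]]) 1 3) (Amalg (pat [:: [:: 3; 0; 2; 1]; [:: 2; 3; 1; 0]]) 0 3))) (Amalg
  (pat [:: [:: 2; 1; 0]; [:: 1; 2; 0]]) 0 2)) (Amalg (pat [:: [:: 3; 2; 0; 1];
  [:: 2; 1; 3; 0]]) 1 3)) (Amalg (pat [:: [:: 1; 3; 2; 0]; [:: 2; 1; 0; 3]]) 1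
  3))) (Amalg (pat [:: [:: 0; 3; 1; 2]; [:: 3; 1; 2; 0]]) 0 3)) (Amalg (pat
  [:: [:: 2; 0; 1]; [:: 1; 2; 0]]) 0 2)))) (Amalg (pat [:: [:: 1; 3; 2; 0];
  [:: 2; 0; 1; 3]]) 2 3))) (Branch (pat [:: [:: 1; 3; 2; 0]; [:: 2; 1; 0; 3]])
  (Branch (pat [:: [:: 1; 0; 2]; [:: 1; 2; 0]]) (Amalg (pat [:: [:: 1; 2; 0;
  3]; [:: 2; 1; 3; 0]]) 0 3) (Branch (pat [:: [:: 0; 2; 1]; [:: 2; 0; 1]])
  (Amalg (pat [:: [:: 0; 2; 3; 1]; [:: 3; 1; 0; 2]]) 0 2) (Branch (pat [:: [::
  2; 1; 0]; [:: 1; 2; 0]]) (Amalg (pat [:: [:: 0; 3; 2; 1]; [:: 3; 1; 2; 0]])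
  0 2) (Branch (pat [:: [:: 1; 2; 0]; [:: 2; 0; 1]]) (Amalg (pat [:: [:: 0; 2;
  3; 1]; [:: 3; 2; 0; 1]]) 0 2) (Branch (pat [:: [:: 2; 0; 1]; [:: 1; 2; 0]])
  (Amalg (pat [:: [:: 1; 3; 0; 2]; [:: 3; 1; 2; 0]]) 0 2) (Branch (pat [:: [::
  2; 1; 0]; [:: 2; 0; 1]]) (Amalg (pat [:: [:: 0; 3; 2; 1]; [:: 3; 2; 0; 1]])
  0 2) (Prim [:: [:: true; true; false]; [:: true; false; false]])))))))
  (Branch (pat [:: [:: 1; 0; 2]; [:: 1; 2; 0]]) (Branch (pat [:: [:: 1; 2; 0];
  [:: 1; 0; 2]]) (Amalg (pat [:: [:: 1; 2; 0; 3]; [:: 2; 1; 3; 0]]) 0 3)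
  (Branch (pat [:: [:: 2; 0; 1; 3]; [:: 1; 3; 2; 0]]) (Branch (pat [:: [:: 0;
  3; 1; 2]; [:: 3; 0; 2; 1]]) (Amalg (pat [:: [:: 2; 0; 4; 1; 3]; [:: 2; 4; 0;
  3; 1]]) 0 2) (Branch (pat [:: [:: 0; 2; 1]; [:: 2; 0; 1]]) (Amalg (pat [::
  [:: 0; 3; 1; 2]; [:: 3; 0; 2; 1]]) 0 3) (Branch (pat [:: [:: 3; 1; 2; 0];
  [:: 0; 3; 1; 2]]) (Branch (pat [:: [:: 2; 1; 0]; [:: 1; 0; 2]]) (Amalg (pat
  [:: [:: 2; 3; 1; 0]; [:: 2; 0; 1; 3]]) 1 3) (Branch (pat [:: [:: 2; 1; 3;
  0]; [:: 2; 3; 0; 1]]) (Branch (pat [:: [:: 3; 2; 1; 0]; [:: 1; 3; 2; 0]])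
  (Branch (pat [:: [:: 2; 3; 1; 0]; [:: 3; 0; 2; 1]]) (Amalg (pat [:: [:: 4;
  2; 3; 1; 0]; [:: 2; 4; 0; 3; 1]]) 0 2) (Amalg (pat [:: [:: 2; 3; 1; 0]; [::
  3; 0; 2; 1]]) 0 3)) (Amalg (pat [:: [:: 3; 2; 1; 0]; [:: 1; 3; 2; 0]]) 1 3))
  (Amalg (pat [:: [:: 2; 1; 3; 0]; [:: 2; 3; 0; 1]]) 0 3))) (Amalg (pat [::
  [:: 3; 1; 2; 0]; [:: 0; 3; 1; 2]]) 1 3)))) (Branch (pat [:: [:: 2; 0; 1];
  [:: 0; 2; 1]]) (Amalg (pat [:: [:: 2; 0; 1; 3]; [:: 1; 3; 2; 0]]) 1 3)
  (Branch (pat [:: [:: 2; 1; 0]; [:: 0; 2; 1]]) (Branch (pat [:: [:: 2; 0; 1];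
  [:: 1; 2; 0]]) (Amalg (pat [:: [:: 3; 2; 0; 1]; [:: 0; 2; 3; 1]]) 0 2)
  (Branch (pat [:: [:: 2; 0; 1]; [:: 2; 1; 0]]) (Amalg (pat [:: [:: 3; 2; 0;
  1]; [:: 0; 3; 2; 1]]) 0 2) (Branch (pat [:: [:: 2; 3; 1; 0]; [:: 3; 0; 2;
  1]]) (Branch (pat [:: [:: 2; 1; 3; 0]; [:: 2; 3; 0; 1]]) (Branch (pat [::
  [:: 3; 2; 1; 0]; [:: 1; 3; 2; 0]]) (Amalg (pat [:: [:: 4; 2; 3; 1; 0]; [::
  2; 4; 0; 3; 1]]) 0 2) (Amalg (pat [:: [:: 3; 2; 1; 0]; [:: 1; 3; 2; 0]]) 1
  3)) (Amalg (pat [:: [:: 2; 1; 3; 0]; [:: 2; 3; 0; 1]]) 0 3)) (Branch (pat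
  [:: [:: 1; 2; 0]; [:: 2; 0; 1]]) (Amalg (pat [:: [:: 2; 3; 1; 0]; [:: 3; 0;
  2; 1]]) 0 3) (Branch (pat [:: [:: 1; 2; 0]; [:: 2; 1; 0]]) (Amalg (pat [::
  [:: 3; 1; 2; 0]; [:: 0; 3; 2; 1]]) 0 1) (Prim [:: [:: true; false; true];
  [:: true; false; false]])))))) (Branch (pat [:: [:: 2; 1; 0]; [:: 1; 0; 2]])
  (Branch (pat [:: [:: 1; 2; 0]; [:: 2; 0; 1]]) (Amalg (pat [:: [:: 2; 3; 1;
  0]; [:: 2; 0; 1; 3]]) 1 3) (Branch (pat [:: [:: 2; 1; 0]; [:: 2; 0; 1]])
  (Branch (pat [:: [:: 3; 2; 1; 0]; [:: 3; 1; 0; 2]]) (Branch (pat [:: [:: 3;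
  2; 1; 0]; [:: 2; 1; 3; 0]]) (Amalg (pat [:: [:: 4; 3; 2; 1; 0]; [:: 3; 1; 4;
  0; 2]]) 2 4) (Branch (pat [:: [:: 2; 1; 0]; [:: 1; 2; 0]]) (Amalg (pat [::
  [:: 3; 2; 1; 0]; [:: 2; 1; 3; 0]]) 1 3) (Amalg (pat [:: [:: 2; 1; 0]; [:: 1;
  2; 0]]) 0 2))) (Amalg (pat [:: [:: 2; 3; 1; 0]; [:: 3; 1; 0; 2]]) 0 1))
  (Amalg (pat [:: [:: 1; 2; 0]; [:: 2; 0; 1]]) 0 1))) (Prim [:: [:: true;
  false; true]])))))) (Branch (pat [:: [:: 1; 2; 0]; [:: 1; 0; 2]]) (Branch
  (pat [:: [:: 0; 2; 1]; [:: 2; 0; 1]]) (Amalg (pat [:: [:: 0; 2; 3; 1]; [::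
  3; 1; 0; 2]]) 0 2) (Branch (pat [:: [:: 0; 2; 1]; [:: 2; 1; 0]]) (Amalg (pat
  [:: [:: 1; 3; 2; 0]; [:: 2; 1; 0; 3]]) 1 3) (Branch (pat [:: [:: 1; 2; 0];
  [:: 2; 1; 0]]) (Branch (pat [:: [:: 1; 0; 2]; [:: 2; 1; 0]]) (Branch (pat
  [:: [:: 2; 1; 0]; [:: 1; 2; 0]]) (Amalg (pat [:: [:: 2; 1; 0; 3]; [:: 2; 3;
  1; 0]]) 1 3) (Branch (pat [:: [:: 2; 1; 3; 0]; [:: 3; 2; 1; 0]]) (Branch
  (pat [:: [:: 3; 1; 0; 2]; [:: 3; 2; 1; 0]]) (Amalg (pat [:: [:: 3; 1; 4; 0;
  2]; [:: 4; 3; 2; 1; 0]]) 2 4) (Branch (pat [:: [:: 2; 0; 1]; [:: 2; 1; 0]])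
  (Amalg (pat [:: [:: 3; 1; 0; 2]; [:: 2; 3; 1; 0]]) 0 1) (Branch (pat [:: [::
  2; 0; 1]; [:: 1; 2; 0]]) (Amalg (pat [:: [:: 2; 0; 1; 3]; [:: 2; 3; 1; 0]])
  1 3) (Amalg (pat [:: [:: 2; 0; 1]; [:: 1; 2; 0]]) 0 1)))) (Amalg (pat [::
  [:: 2; 1; 3; 0]; [:: 3; 2; 1; 0]]) 0 3))) (Prim [:: [:: true; true;
  false]])) (Amalg (pat [:: [:: 1; 2; 0]; [:: 2; 1; 0]]) 0 2)))) (Amalg (pat
  [:: [:: 1; 2; 0]; [:: 1; 0; 2]]) 1 2))))))) (Amalg (pat [:: [:: 2; 1; 0];
  [:: 0; 1; 2]]) 0 2)) (Dist 0 1 true)) (Dist 0 2 true)) (Dist 1 2 true)).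

(** A triangle with two pairs on which all three orders agree, and a third pair reversed in one
    order only. *)
Definition near_triangle_tree : pattern * tree :=
  (pat [:: [:: 0; 1; 2]; [:: 0; 2; 1]],
  Branch (pat [:: [:: 0; 1; 2]; [:: 1; 2; 0]]) (Branch (pat [:: [:: 0; 1; 2];
  [:: 0; 1; 2]]) (Branch (pat [:: [:: 1; 0; 2; 3]; [:: 2; 0; 1; 3]]) (Branch
  (pat [:: [:: 1; 2; 0]; [:: 0; 2; 1]]) (Amalg (pat [:: [:: 1; 2; 0; 3]; [::
  0; 3; 1; 2]]) 0 3) (Branch (pat [:: [:: 0; 1; 2; 3]; [:: 2; 1; 3; 0]])
  (Branch (pat [:: [:: 0; 2; 1]; [:: 0; 2; 1]]) (Amalg (pat [:: [:: 0; 2; 1;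
  3]; [:: 0; 3; 1; 2]]) 0 3) (Branch (pat [:: [:: 2; 0; 1]; [:: 2; 0; 1]])
  (Branch (pat [:: [:: 3; 1; 0; 2]; [:: 3; 1; 0; 2]]) (Branch (pat [:: [:: 2;
  1; 3; 0]; [:: 2; 1; 3; 0]]) (Amalg (pat [:: [:: 3; 1; 4; 0; 2]; [:: 3; 1; 4;
  0; 2]]) 2 4) (Branch (pat [:: [:: 1; 2; 0]; [:: 1; 2; 0]]) (Amalg (pat [::
  [:: 2; 1; 3; 0]; [:: 2; 1; 3; 0]]) 0 3) (Branch (pat [:: [:: 0; 2; 1; 3];
  [:: 1; 2; 0; 3]]) (Branch (pat [:: [:: 0; 2; 1; 3]; [:: 2; 3; 0; 1]])
  (Branch (pat [:: [:: 0; 1; 2; 3]; [:: 3; 1; 0; 2]]) (Amalg (pat [:: [:: 0;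
  1; 2; 3; 4]; [:: 3; 1; 4; 0; 2]]) 2 4) (Amalg (pat [:: [:: 0; 1; 2; 3]; [::
  3; 1; 0; 2]]) 0 2)) (Amalg (pat [:: [:: 0; 2; 1; 3]; [:: 2; 3; 0; 1]]) 0 3))
  (Amalg (pat [:: [:: 1; 2; 0; 3]; [:: 1; 2; 0; 3]]) 0 2)))) (Amalg (pat [::
  [:: 3; 1; 0; 2]; [:: 3; 1; 0; 2]]) 0 2)) (Amalg (pat [:: [:: 2; 0; 1]; [::
  2; 0; 1]]) 0 1))) (Amalg (pat [:: [:: 0; 1; 2; 3]; [:: 2; 1; 3; 0]]) 0 3)))
  (Branch (pat [:: [:: 0; 1; 2; 3]; [:: 2; 1; 3; 0]]) (Branch (pat [:: [:: 1;
  0; 2]; [:: 2; 0; 1]]) (Amalg (pat [:: [:: 1; 0; 2; 3]; [:: 2; 0; 1; 3]]) 1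
  3) (Branch (pat [:: [:: 0; 1; 2; 3]; [:: 3; 1; 0; 2]]) (Amalg (pat [:: [::
  0; 1; 2; 3; 4]; [:: 3; 1; 4; 0; 2]]) 2 4) (Branch (pat [:: [:: 0; 1; 2]; [::
  2; 0; 1]]) (Amalg (pat [:: [:: 0; 1; 2; 3]; [:: 3; 1; 0; 2]]) 0 2) (Branch
  (pat [:: [:: 1; 0; 2]; [:: 0; 2; 1]]) (Branch (pat [:: [:: 1; 0; 2; 3]; [::
  0; 2; 1; 3]]) (Branch (pat [:: [:: 0; 2; 1]; [:: 0; 1; 2]]) (Amalg (pat [::
  [:: 0; 2; 1; 3]; [:: 0; 1; 3; 2]]) 0 3) (Branch (pat [:: [:: 2; 0; 1; 3];
  [:: 0; 2; 3; 1]]) (Branch (pat [:: [:: 3; 1; 0; 2]; [:: 0; 1; 2; 3]])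
  (Branch (pat [:: [:: 2; 1; 3; 0]; [:: 0; 1; 2; 3]]) (Amalg (pat [:: [:: 3;
  1; 4; 0; 2]; [:: 0; 1; 2; 3; 4]]) 2 4) (Branch (pat [:: [:: 1; 2; 0]; [:: 0;
  1; 2]]) (Amalg (pat [:: [:: 2; 1; 3; 0]; [:: 0; 1; 2; 3]]) 0 3) (Amalg (pat
  [:: [:: 1; 2; 0]; [:: 0; 1; 2]]) 0 2))) (Amalg (pat [:: [:: 3; 1; 0; 2]; [::
  0; 1; 2; 3]]) 0 2)) (Amalg (pat [:: [:: 2; 0; 1; 3]; [:: 0; 2; 3; 1]]) 0
  2))) (Amalg (pat [:: [:: 1; 0; 2; 3]; [:: 0; 2; 1; 3]]) 0 3)) (Amalg (pat
  [:: [:: 0; 1; 2]; [:: 2; 0; 1]]) 0 1))))) (Branch (pat [:: [:: 0; 1; 2]; [::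
  1; 0; 2]]) (Amalg (pat [:: [:: 0; 1; 2; 3]; [:: 2; 1; 3; 0]]) 0 3) (Branch
  (pat [:: [:: 0; 3; 1; 2]; [:: 1; 3; 2; 0]]) (Branch (pat [:: [:: 2; 0; 1];
  [:: 1; 0; 2]]) (Amalg (pat [:: [:: 3; 0; 1; 2]; [:: 2; 1; 0; 3]]) 1 3)
  (Branch (pat [:: [:: 1; 0; 2]; [:: 2; 0; 1]]) (Amalg (pat [:: [:: 0; 2; 1;
  3]; [:: 0; 3; 1; 2]]) 0 3) (Branch (pat [:: [:: 1; 0; 3; 2]; [:: 0; 2; 3;
  1]]) (Branch (pat [:: [:: 0; 2; 1]; [:: 0; 1; 2]]) (Amalg (pat [:: [:: 0; 2;
  1; 3]; [:: 0; 1; 3; 2]]) 0 3) (Branch (pat [:: [:: 0; 2; 1]; [:: 1; 0; 2]])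
  (Amalg (pat [:: [:: 0; 2; 1; 3]; [:: 1; 0; 2; 3]]) 0 3) (Branch (pat [:: [::
  2; 0; 1]; [:: 0; 1; 2]]) (Branch (pat [:: [:: 3; 1; 0; 2]; [:: 0; 1; 2; 3]])
  (Branch (pat [:: [:: 2; 1; 3; 0]; [:: 0; 1; 2; 3]]) (Amalg (pat [:: [:: 3;
  1; 4; 0; 2]; [:: 0; 1; 2; 3; 4]]) 2 4) (Branch (pat [:: [:: 1; 2; 0]; [:: 0;
  1; 2]]) (Amalg (pat [:: [:: 2; 1; 3; 0]; [:: 0; 1; 2; 3]]) 0 3) (Amalg (pat
  [:: [:: 1; 2; 0]; [:: 0; 1; 2]]) 0 2))) (Amalg (pat [:: [:: 3; 1; 0; 2]; [::
  0; 1; 2; 3]]) 0 2)) (Amalg (pat [:: [:: 2; 0; 1]; [:: 0; 1; 2]]) 0 1))))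
  (Amalg (pat [:: [:: 0; 1; 3; 2]; [:: 2; 0; 3; 1]]) 0 1)))) (Branch (pat [::
  [:: 0; 2; 1]; [:: 0; 1; 2]]) (Branch (pat [:: [:: 2; 0; 1]; [:: 0; 2; 1]])
  (Amalg (pat [:: [:: 0; 3; 1; 2]; [:: 0; 1; 3; 2]]) 0 3) (Branch (pat [:: [::
  1; 0; 2]; [:: 0; 2; 1]]) (Amalg (pat [:: [:: 0; 2; 1; 3]; [:: 0; 1; 3; 2]])
  0 3) (Branch (pat [:: [:: 0; 2; 1; 3]; [:: 0; 1; 2; 3]]) (Branch (pat [::
  [:: 0; 3; 2; 1]; [:: 1; 2; 0; 3]]) (Amalg (pat [:: [:: 0; 3; 2; 1; 4]; [::
  1; 2; 0; 3; 4]]) 2 4) (Branch (pat [:: [:: 1; 2; 0]; [:: 1; 0; 2]]) (Amalg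
  (pat [:: [:: 1; 2; 0; 3]; [:: 1; 0; 2; 3]]) 0 3) (Branch (pat [:: [:: 0; 2;
  1]; [:: 1; 0; 2]]) (Amalg (pat [:: [:: 0; 2; 1; 3]; [:: 1; 0; 2; 3]]) 0 3)
  (Branch (pat [:: [:: 0; 2; 1]; [:: 0; 2; 1]]) (Branch (pat [:: [:: 1; 2; 0];
  [:: 2; 1; 0]]) (Amalg (pat [:: [:: 0; 2; 3; 1]; [:: 0; 3; 2; 1]]) 0 2)
  (Branch (pat [:: [:: 1; 2; 0]; [:: 2; 0; 1]]) (Amalg (pat [:: [:: 0; 2; 3;
  1]; [:: 1; 3; 0; 2]]) 0 2) (Branch (pat [:: [:: 2; 0; 1]; [:: 2; 1; 0]])
  (Amalg (pat [:: [:: 0; 3; 1; 2]; [:: 1; 3; 2; 0]]) 0 3) (Branch (pat [:: [::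
  1; 0; 2]; [:: 2; 0; 1]]) (Amalg (pat [:: [:: 0; 2; 1; 3]; [:: 0; 3; 1; 2]])
  0 3) (Branch (pat [:: [:: 0; 2; 1]; [:: 1; 2; 0]]) (Amalg (pat [:: [:: 0; 1;
  3; 2]; [:: 2; 0; 3; 1]]) 0 1) (Branch (pat [:: [:: 2; 0; 1]; [:: 1; 2; 0]])
  (Amalg (pat [:: [:: 2; 0; 3; 1]; [:: 1; 2; 3; 0]]) 2 3) (Prim [:: [:: true;
  true; true]; [:: true; false; true]; [:: true; false; false]]))))))) (Branch
  (pat [:: [:: 2; 0; 1]; [:: 2; 0; 1]]) (Branch (pat [:: [:: 1; 2; 0]; [:: 0;
  2; 1]]) (Amalg (pat [:: [:: 0; 2; 3; 1]; [:: 0; 1; 3; 2]]) 0 2) (Branch (pat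
  [:: [:: 2; 1; 0]; [:: 1; 0; 2]]) (Amalg (pat [:: [:: 0; 3; 2; 1]; [:: 1; 2;
  0; 3]]) 0 2) (Branch (pat [:: [:: 2; 1; 0]; [:: 0; 2; 1]]) (Amalg (pat [::
  [:: 0; 3; 2; 1]; [:: 0; 1; 3; 2]]) 0 2) (Branch (pat [:: [:: 3; 1; 0; 2];
  [:: 3; 1; 0; 2]]) (Branch (pat [:: [:: 1; 2; 0; 3]; [:: 1; 2; 0; 3]])
  (Branch (pat [:: [:: 2; 1; 3; 0]; [:: 2; 1; 3; 0]]) (Amalg (pat [:: [:: 3;
  1; 4; 0; 2]; [:: 3; 1; 4; 0; 2]]) 2 4) (Amalg (pat [:: [:: 2; 1; 3; 0]; [::
  2; 1; 3; 0]]) 0 3)) (Amalg (pat [:: [:: 1; 2; 0; 3]; [:: 1; 2; 0; 3]]) 0 2))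
  (Branch (pat [:: [:: 1; 0; 2]; [:: 1; 0; 2]]) (Amalg (pat [:: [:: 3; 1; 0;
  2]; [:: 3; 1; 0; 2]]) 0 2) (Branch (pat [:: [:: 2; 0; 1]; [:: 1; 0; 2]])
  (Branch (pat [:: [:: 2; 0; 1]; [:: 2; 1; 0]]) (Amalg (pat [:: [:: 3; 0; 1;
  2]; [:: 2; 1; 0; 3]]) 1 3) (Branch (pat [:: [:: 1; 2; 0]; [:: 2; 1; 0]])
  (Amalg (pat [:: [:: 2; 3; 0; 1]; [:: 2; 1; 0; 3]]) 1 3) (Branch (pat [:: [::
  0; 2; 1]; [:: 1; 2; 0]]) (Amalg (pat [:: [:: 0; 3; 1; 2]; [:: 1; 2; 0; 3]])
  0 3) (Branch (pat [:: [:: 2; 0; 1]; [:: 1; 2; 0]]) (Amalg (pat [:: [:: 2; 0;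
  3; 1]; [:: 1; 2; 3; 0]]) 2 3) (Branch (pat [:: [:: 0; 2; 1]; [:: 2; 1; 0]])
  (Branch (pat [:: [:: 1; 0; 2]; [:: 2; 0; 1]]) (Amalg (pat [:: [:: 1; 0; 3;
  2]; [:: 3; 1; 2; 0]]) 1 3) (Branch (pat [:: [:: 1; 2; 0]; [:: 2; 0; 1]])
  (Amalg (pat [:: [:: 1; 3; 2; 0]; [:: 3; 1; 0; 2]]) 2 3) (Prim [:: [:: true;
  true; true]; [:: true; false; true]; [:: true; false; false]]))) (Amalg (pat
  [:: [:: 2; 0; 1]; [:: 1; 2; 0]]) 0 1)))))) (Prim [:: [:: true; true; true];
  [:: true; false; true]]))))))) (Amalg (pat [:: [:: 2; 0; 1]; [:: 2; 0; 1]])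
  0 1)))))) (Branch (pat [:: [:: 1; 0; 2]; [:: 0; 1; 2]]) (Amalg (pat [:: [::
  0; 2; 1; 3]; [:: 0; 1; 2; 3]]) 0 3) (Branch (pat [:: [:: 2; 0; 1]; [:: 0; 1;
  2]]) (Branch (pat [:: [:: 3; 0; 2; 1]; [:: 0; 1; 2; 3]]) (Branch (pat [::
  [:: 1; 3; 2; 0]; [:: 0; 1; 2; 3]]) (Amalg (pat [:: [:: 2; 4; 0; 3; 1]; [::
  0; 1; 2; 3; 4]]) 0 2) (Branch (pat [:: [:: 1; 2; 0]; [:: 0; 1; 2]]) (Amalg
  (pat [:: [:: 1; 3; 2; 0]; [:: 0; 1; 2; 3]]) 1 3) (Branch (pat [:: [:: 1; 2;
  0]; [:: 0; 2; 1]]) (Branch (pat [:: [:: 0; 2; 1]; [:: 1; 0; 2]]) (Amalg (pat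
  [:: [:: 0; 2; 3; 1]; [:: 1; 0; 3; 2]]) 0 2) (Branch (pat [:: [:: 1; 0; 2];
  [:: 2; 0; 1]]) (Amalg (pat [:: [:: 1; 2; 0; 3]; [:: 0; 3; 1; 2]]) 0 3)
  (Branch (pat [:: [:: 0; 2; 3; 1]; [:: 0; 1; 3; 2]]) (Branch (pat [:: [:: 1;
  2; 0]; [:: 2; 1; 0]]) (Amalg (pat [:: [:: 0; 2; 3; 1]; [:: 0; 3; 2; 1]]) 0
  2) (Branch (pat [:: [:: 1; 2; 0]; [:: 2; 0; 1]]) (Amalg (pat [:: [:: 0; 2;
  3; 1]; [:: 1; 3; 0; 2]]) 0 2) (Branch (pat [:: [:: 2; 0; 1]; [:: 2; 1; 0]])
  (Amalg (pat [:: [:: 0; 3; 1; 2]; [:: 1; 3; 2; 0]]) 0 3) (Branch (pat [:: [::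
  0; 2; 1]; [:: 1; 2; 0]]) (Amalg (pat [:: [:: 0; 1; 3; 2]; [:: 2; 0; 3; 1]])
  0 1) (Branch (pat [:: [:: 1; 2; 0]; [:: 1; 0; 2]]) (Amalg (pat [:: [:: 2; 0;
  3; 1]; [:: 2; 0; 1; 3]]) 0 1) (Branch (pat [:: [:: 2; 0; 1]; [:: 1; 2; 0]])
  (Amalg (pat [:: [:: 2; 3; 0; 1]; [:: 0; 2; 3; 1]]) 0 2) (Prim [:: [:: true;
  true; true]; [:: true; false; true]; [:: true; false; false]]))))))) (Amalg
  (pat [:: [:: 0; 2; 3; 1]; [:: 0; 1; 3; 2]]) 0 2)))) (Amalg (pat [:: [:: 1;
  2; 0]; [:: 0; 1; 2]]) 1 2)))) (Amalg (pat [:: [:: 3; 0; 2; 1]; [:: 0; 1; 2;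
  3]]) 0 2)) (Amalg (pat [:: [:: 2; 0; 1]; [:: 0; 1; 2]]) 0 2)))))) (Branch
  (pat [:: [:: 1; 2; 0]; [:: 0; 1; 2]]) (Branch (pat [:: [:: 2; 1; 3; 0]; [::
  0; 1; 2; 3]]) (Branch (pat [:: [:: 3; 1; 0; 2]; [:: 0; 1; 2; 3]]) (Amalg
  (pat [:: [:: 3; 1; 4; 0; 2]; [:: 0; 1; 2; 3; 4]]) 2 4) (Branch (pat [:: [::
  2; 0; 1]; [:: 0; 1; 2]]) (Amalg (pat [:: [:: 3; 1; 0; 2]; [:: 0; 1; 2; 3]])
  0 2) (Branch (pat [:: [:: 1; 2; 0]; [:: 1; 0; 2]]) (Amalg (pat [:: [:: 1; 2;
  0; 3]; [:: 1; 0; 2; 3]]) 0 3) (Branch (pat [:: [:: 0; 2; 1]; [:: 1; 0; 2]])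
  (Amalg (pat [:: [:: 0; 2; 1; 3]; [:: 1; 0; 2; 3]]) 0 3) (Branch (pat [:: [::
  2; 0; 1]; [:: 1; 0; 2]]) (Branch (pat [:: [:: 2; 0; 1]; [:: 2; 1; 0]])
  (Amalg (pat [:: [:: 3; 0; 1; 2]; [:: 2; 1; 0; 3]]) 1 3) (Branch (pat [:: [::
  1; 0; 2]; [:: 0; 2; 1]]) (Amalg (pat [:: [:: 2; 0; 1; 3]; [:: 0; 2; 3; 1]])
  0 2) (Branch (pat [:: [:: 2; 0; 1]; [:: 0; 2; 1]]) (Amalg (pat [:: [:: 2; 0;
  1; 3]; [:: 0; 3; 1; 2]]) 1 3) (Branch (pat [:: [:: 1; 2; 0]; [:: 2; 1; 0]])
  (Amalg (pat [:: [:: 2; 3; 0; 1]; [:: 2; 1; 0; 3]]) 1 3) (Branch (pat [:: [::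
  0; 2; 1]; [:: 0; 2; 1]]) (Amalg (pat [:: [:: 0; 3; 1; 2]; [:: 0; 2; 1; 3]])
  0 3) (Branch (pat [:: [:: 2; 0; 1]; [:: 2; 0; 1]]) (Branch (pat [:: [:: 1;
  2; 0]; [:: 2; 0; 1]]) (Amalg (pat [:: [:: 2; 3; 0; 1]; [:: 3; 0; 1; 2]]) 1
  3) (Branch (pat [:: [:: 0; 2; 1]; [:: 1; 2; 0]]) (Amalg (pat [:: [:: 0; 3;
  1; 2]; [:: 1; 2; 0; 3]]) 0 3) (Branch (pat [:: [:: 2; 0; 1]; [:: 1; 2; 0]])
  (Amalg (pat [:: [:: 2; 0; 3; 1]; [:: 1; 2; 3; 0]]) 2 3) (Branch (pat [:: [::
  0; 2; 1]; [:: 2; 1; 0]]) (Branch (pat [:: [:: 1; 0; 2]; [:: 2; 0; 1]])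
  (Amalg (pat [:: [:: 1; 0; 3; 2]; [:: 3; 1; 2; 0]]) 1 3) (Prim [:: [:: true;
  true; true]; [:: true; false; true]; [:: true; false; false]])) (Amalg (pat
  [:: [:: 2; 0; 1]; [:: 1; 2; 0]]) 0 1))))) (Amalg (pat [:: [:: 2; 0; 1]; [::
  2; 0; 1]]) 0 1))))))) (Amalg (pat [:: [:: 2; 0; 1]; [:: 0; 1; 2]]) 0 1))))))
  (Branch (pat [:: [:: 1; 0; 2]; [:: 0; 1; 2]]) (Amalg (pat [:: [:: 2; 1; 3;
  0]; [:: 0; 1; 2; 3]]) 0 3) (Branch (pat [:: [:: 0; 2; 1]; [:: 0; 2; 1]])
  (Branch (pat [:: [:: 1; 2; 0]; [:: 2; 1; 0]]) (Amalg (pat [:: [:: 0; 2; 3;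
  1]; [:: 0; 3; 2; 1]]) 0 2) (Branch (pat [:: [:: 2; 0; 1]; [:: 2; 1; 0]])
  (Amalg (pat [:: [:: 0; 3; 1; 2]; [:: 1; 3; 2; 0]]) 0 3) (Branch (pat [:: [::
  2; 1; 0]; [:: 1; 2; 0]]) (Amalg (pat [:: [:: 0; 3; 2; 1]; [:: 0; 2; 3; 1]])
  0 2) (Branch (pat [:: [:: 1; 0; 2]; [:: 2; 0; 1]]) (Amalg (pat [:: [:: 0; 2;
  1; 3]; [:: 0; 3; 1; 2]]) 0 3) (Branch (pat [:: [:: 0; 2; 1]; [:: 1; 2; 0]])
  (Amalg (pat [:: [:: 0; 1; 3; 2]; [:: 2; 0; 3; 1]]) 0 1) (Branch (pat [:: [::
  2; 1; 0]; [:: 2; 0; 1]]) (Amalg (pat [:: [:: 0; 3; 2; 1]; [:: 1; 3; 0; 2]])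
  0 2) (Branch (pat [:: [:: 2; 0; 1]; [:: 1; 0; 2]]) (Amalg (pat [:: [:: 0; 3;
  1; 2]; [:: 0; 2; 1; 3]]) 0 3) (Branch (pat [:: [:: 1; 2; 0]; [:: 0; 2; 1]])
  (Amalg (pat [:: [:: 2; 0; 3; 1]; [:: 0; 1; 3; 2]]) 0 1) (Prim [:: [:: true;
  true; true]; [:: true; false; false]]))))))))) (Branch (pat [:: [:: 1; 0;
  2]; [:: 1; 0; 2]]) (Branch (pat [:: [:: 1; 2; 0; 3]; [:: 1; 2; 0; 3]])
  (Branch (pat [:: [:: 2; 0; 1]; [:: 2; 0; 1]]) (Branch (pat [:: [:: 3; 1; 0;
  2]; [:: 3; 1; 0; 2]]) (Branch (pat [:: [:: 2; 1; 3; 0]; [:: 2; 1; 3; 0]])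
  (Amalg (pat [:: [:: 3; 1; 4; 0; 2]; [:: 3; 1; 4; 0; 2]]) 2 4) (Amalg (pat
  [:: [:: 2; 1; 3; 0]; [:: 2; 1; 3; 0]]) 0 3)) (Amalg (pat [:: [:: 3; 1; 0;
  2]; [:: 3; 1; 0; 2]]) 0 2)) (Amalg (pat [:: [:: 2; 0; 1]; [:: 2; 0; 1]]) 0
  1)) (Amalg (pat [:: [:: 1; 2; 0; 3]; [:: 1; 2; 0; 3]]) 0 2)) (Prim [:: [::
  true; true; true]]))))) (Amalg (pat [:: [:: 1; 2; 0]; [:: 0; 1; 2]]) 0
  2))))))) (Amalg (pat [:: [:: 0; 1; 2]; [:: 0; 1; 2]]) 0 2)) (Amalg (pat [::
  [:: 0; 1; 2]; [:: 1; 2; 0]]) 0 2)).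

(** A triangle whose three pairs have three different types. *)
Definition rainbow_triangle_tree : pattern * tree :=
  (pat [:: [:: 0; 2; 1]; [:: 1; 0; 2]],
  Branch (pat [:: [:: 3; 2; 1; 0]; [:: 3; 0; 2; 1]]) (Branch (pat [:: [:: 1;
  3; 2; 0]; [:: 1; 3; 2; 0]]) (Amalg (pat [:: [:: 1; 4; 3; 2; 0]; [:: 2; 4; 0;
  3; 1]]) 0 2) (Amalg (pat [:: [:: 1; 3; 2; 0]; [:: 1; 3; 2; 0]]) 1 3)) (Amalg
  (pat [:: [:: 3; 2; 1; 0]; [:: 3; 0; 2; 1]]) 0 3)).

(** * From small patterns to the theorem *)

Section Generic.
Variables (k : nat) (M : structure 'I_k.+1).
Hypothesis Mperm : permutation_structure M.
Hypothesis Mhom : ultrahomogeneous M.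

Section Derivable.
Hypothesis Mprim : primitive M.
Hypothesis Mdist : distinct_orders M.

Lemma lhas_pred0 (T : Type) (t : pred T) s : t =1 pred0 -> lhas t s = false.
Proof. by move=> t0; elim: s => //= a s ->; rewrite t0. Qed.

(** If [p] did not occur, soundness would make [check] fail on every tree whatever its origin, and
    [derivable] would evaluate to [false]. *)
Lemma derivable_occurs trees K p : derivable k.+1 trees K p ->
  (forall q, q \in K -> occurs M q) -> occurs M p.
Proof.
move=> der KM; apply: contrapT => pM.
have refute t : check k.+1 t K [:: p] = false.
  apply/negP => /(check_sound Mperm Mhom Mprim Mdist); apply=> // q.
  by rewrite inE => /eqP ->.
suff : derivable k.+1 trees K p = false by rewrite der.
rewrite /derivable (negPf (_ : ~~ knows k.+1 K p)); last first.
  by apply/negP => /(knows_occurs KM).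
rewrite lhas_pred0 // {1}/assisted lhas_pred0 => [|ij].
  apply: lhas_pred0 => g; apply: lhas_pred0 => t; rewrite refute.
  by case: iso.
apply: lhas_pred0 => z; apply: lhas_pred0 => ti; apply: lhas_pred0 => tj.
exact: refute.
Qed.

Lemma derivable_upto4_occurs trees n p : derivable_upto4 k.+1 trees ->
  0 < n <= 4 -> p \in all_patterns k.+1 n -> occurs M p.
Proof.
rewrite /derivable_upto4 !lallE; case: allP => // d2.
have o2 q : q \in all_patterns k.+1 2 -> occurs M q.
  by move=> /d2/derivable_occurs; apply.
case: allP => // d3.
have o3 q : q \in all_patterns k.+1 3 -> occurs M q.
  move=> /d3/derivable_occurs; apply=> r; rewrite mem_filter.
  by case/andP => /derivable_occurs dr _; apply: dr.
move=> /allP d4.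
have o4 q : q \in all_patterns k.+1 4 -> occurs M q.
  by move=> /d4/derivable_occurs; apply.
case: n => [|[|[|[|[|]]]]] // _; [|exact: o2|exact: o3|exact: o4].
case/mapP => cols _ -> /=.
(* A one-point pattern only asks for a point of [M]. *)
have [x [y [xy _]]] := Mdist (i := ord0) (j := ord0) (s := true) isT.
exists (fun=> x) => i a b; rewrite !inE => /eqP -> /eqP ->.
by rewrite ltnn; split=> // /(lin_irr (Mperm i)).
Qed.

End Derivable.

(** Adjoining to [P] an ideal point [None] in the box gives a permutation structure on at most four
    points. Its pattern occurs in [M], and an automorphism brings the copy of [P] back to [P]. *)
Lemma one_point_extension3 : M ->
  (forall n p, 0 < n <= 4 -> p \in all_patterns k.+1 n -> occurs M p) ->
  one_point_extension M 3.
Proof.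
move=> x0 occ T a P c cardP a_inj c_cons.
pose X : finType := option {t : T | t \in P}.
pose rel (i : 'I_k.+1) (o o' : X) : Prop := match o, o' with
  | Some s, Some t => srel i (a (val s)) (a (val t))
  | Some s, None => c i (val s)
  | None, Some t => ~~ c i (val t)
  | None, None => False
  end.
pose A : structure 'I_k.+1 := Structure rel.
have Aperm : permutation_structure A.
  move=> i; split.
  - by move=> [s|] //=; apply: (lin_irr (Mperm i)).
  - move=> [[s sP]|] [[t tP]|] [[u uP]|] //=.
    + exact: (lin_trans (Mperm i)).
    + exact: c_cons.
    + move=> cs /negP cu; have [e|su] := eqVneq s u; first by rewrite -e in cu.
      have nsu : a s <> a u by move/(a_inj _ _ sP uP) => e; rewrite e eqxx in su.
      have [//|us] := lin_total (Mperm i) nsu.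
      by case: cu; apply: (c_cons i _ _ uP sP us).
    + by move=> /negP ct tu; apply/negP => /(c_cons i _ _ tP uP tu).
    + by move=> /negP.
  - move=> [s|] [t|] //= st.
    + apply: (lin_total (Mperm i)) => /(a_inj _ _ (valP s) (valP t)) e.
      by apply: st; congr Some; apply: val_inj.
    + by case: (c i (val s)); [left|right].
    + by case: (c i (val t)); [right|left].
have cardX : #|X| = #|P|.+1 by rewrite card_option card_sig.
pose x s : A := enum_val (cast_ord (esym cardX) s).
have x_inj : injective x by move=> s t /enum_val_inj/cast_ord_inj.
have [p pP [f fP fx]] := exists_pattern Aperm x_inj.
have [h hP] := occ #|P|.+1 p cardP pP.
have [v vP] : {v : A -> vertex & forall o, v o \in p /\ f (v o) = o}.
  apply: (boolp.choice (P := fun o b => b \in p /\ f b = o)) => o.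
  have [b bp fb] := fx (cast_ord cardX (enum_rank o)).
  by exists b; split=> //; rewrite fb /x cast_ordK enum_rankK.
have hv i o o' : srel (s := A) i o o' <-> srel i (h (v o)) (h (v o')).
  have [[vo fo] [vo' fo']] := (vP o, vP o').
  by rewrite hP // -{1}fo -{1}fo' fP.
have [g [_ gh] gP] : exists2 g : M -> M, automorphism g &
    forall s, s \in enum {: {t : T | t \in P}} -> g (h (v (Some s))) = a (val s).
  apply: extend_seq => // i s t _ _; apply: iff_sym; exact: (hv i (Some s) (Some t)).
exists (g (h (v None))) => i t tP.
have gt := gP (exist _ t tP) (mem_enum _ _); rewrite /= in gt.
rewrite -gt; case ct: (c i t); rewrite -gh -hv //=.
by rewrite ct.
Qed.

Lemma distinct_orders_of_nontrivial (x0 y0 : M) : x0 <> y0 ->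
  (forall i j : 'I_k.+1, i != j ->
     ~ (forall x y : M, srel i x y <-> srel j x y) /\
     ~ (forall x y : M, srel i x y <-> srel j y x)) ->
  distinct_orders M.
Proof.
move=> xy0 dist i j s; have [<-|ij] /= := eqVneq i j.
  by move=> ->; exists x0, y0.
move=> _; have [d1 d2] := dist i j ij; apply: contrapT => none.
have tot l x y : x <> y -> srel (s := M) l y x <-> ~ srel l x y.
  move=> xy; split=> [yx xy'|]; first exact: (lin_asym (Mperm l) xy' yx).
  exact: (lin_notr (Mperm l)).
have irr l x := lin_irr (Mperm l) (x := x).
case: s none => none; [apply: d2|apply: d1] => x y.
  have [<-|xy] := pselect (x = y); first by split=> /irr.
  have : ~ (srel i x y <-> srel j x y) by move=> h; apply: none; exists x, y.
  rewrite (tot j x y) //.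
  by have := pselect (srel i x y); have := pselect (srel j x y); tauto.
have [<-|xy] := pselect (x = y); first by split=> /irr.
have : ~ (srel i x y <-> srel j y x) by move=> h; apply: none; exists x, y.
rewrite (tot j x y) //.
by have := pselect (srel i x y); have := pselect (srel j x y); tauto.
Qed.

End Generic.

Lemma generic_of_distinct (k : nat) (M : structure 'I_k) :
  0 < k <= 3 -> permutation_structure M -> homogeneous M -> primitive M ->
  (forall i j : 'I_k, i != j ->
     ~ (forall x y : M, srel i x y <-> srel j x y) /\
     ~ (forall x y : M, srel i x y <-> srel j y x)) ->
  generic_permutation_structure M.
Proof.
case: k M => // k M k3 Mperm [Mcard Mhom] Mprim dist.
have /card_set_bijP [f [_ _ f_surj]] := Mcard.
have [x0 _ fx0] := f_surj 0 I; have [y0 _ fy0] := f_surj 1 I.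
have xy0 : x0 <> y0 by move=> e; move: fy0; rewrite -e fx0.
have Mdist := distinct_orders_of_nontrivial Mperm xy0 dist.
apply: generic_of_extension => //.
  by rewrite (eq_countable Mcard).
apply: (one_point_extension_all Mperm Mhom (m := 3)) => //.
apply: one_point_extension3 => // n p n4 pP.
have [trees] : exists trees, derivable_upto4 k.+1 trees.
  case: k k3 {M Mperm Mcard Mhom Mprim dist f f_surj x0 fx0 y0 fy0 xy0 Mdist pP} =>
    [|[|[|]]] // _.
  (* With a single order, the two-point pattern occurs as soon as there are two points. *)
  - exists [:: (pat [:: iota 0 2], Dist 0 0 true)]; by vm_compute.
  (* With two orders, the two types of pairs are agreement and disagreement. *)
  - exists [:: (pat [:: [:: 0; 1]], Dist 0 1 true); (pat [:: [:: 1; 0]], Dist 0 1 false);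
              planar_triangle_tree]; by vm_compute.
  - exists [:: two_types_tree; near_triangle_tree; rainbow_triangle_tree].
    by vm_compute.
by move/(derivable_upto4_occurs Mperm Mhom Mprim Mdist); apply; [exact: n4|].
Qed.

Theorem theorem3p1 (G : structure 'I_3) (Gperm : permutation_structure G)
    (Ghom : homogeneous G) (Gprim : primitive G) :
  exists S : {set 'I_3},
    [/\ S != set0,
        (forall j : 'I_3, exists i : 'I_3,
            i \in S /\
            ((forall x y : G, srel j x y <-> srel i x y) \/
             (forall x y : G, srel j x y <-> opp_rel (srel (s := G) i) x y))) &
        generic_permutation_structure
          (reduct (fun k : 'I_#|S| => enum_val k) G)].
Proof.
pose similar (j i : 'I_3) := (forall x y : G, srel j x y <-> srel i x y) \/
  (forall x y : G, srel j x y <-> opp_rel (srel (s := G) i) x y).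
have sim_trans j i l : similar j i -> similar i l -> similar j l.
  move=> [ji|ji] [il|il]; [left|right|right|left] => x y; rewrite ji ?il //.
  - by rewrite /opp_rel il.
  - by rewrite /opp_rel il.
pose covers (S : {set 'I_3}) := `[< forall j, exists2 i, i \in S & similar j i >].
have coversT : covers finset.setT.
  by apply/asboolP => j; exists j; [rewrite inE|left].
(* A smallest covering set contains one order from each class: of two similar members, one could be
   removed. *)
case: (arg_minnP (fun S : {set 'I_3} => #|S|) coversT) => S /asboolP covS minS.
have S_gt0 : 0 < #|S|.
  by have [i iS _] := covS ord0; rewrite (cardD1 i) iS.
exists S; split; first by rewrite -card_gt0.
  by move=> j; have [i iS ji] := covS j; exists i.
have cov i : exists j : 'I_#|S|, similar i (enum_val j).
  have [l lS il] := covS i; exists (enum_rank_in lS l).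
  by rewrite enum_rankK_in.
apply: generic_of_distinct.
- by rewrite S_gt0; have := max_card S; rewrite card_ord.
- by move=> i; apply: Gperm.
- by split; [exact: Ghom.1|apply: ultrahomogeneous_reduct Ghom.2].
- exact: primitive_reduct.
move=> i j ij; suff nsim : ~ similar (enum_val i) (enum_val j).
  by split=> h; apply: nsim; [left|right].
move=> sim_ij; have := minS (S :\ enum_val i); rewrite leqNgt.
rewrite [X in _ < X](cardsD1 (enum_val i)) enum_valP ltnS leqnn.
move=> /(_ _)/negP; apply => //; apply/asboolP => l.
have [m mS lm] := covS l; have [e|ne] := eqVneq m (enum_val i).
  exists (enum_val j); last by apply: sim_trans lm _; rewrite e.
  rewrite !inE enum_valP andbT; apply: contra ij => /eqP/enum_val_inj -> //.
by exists m; rewrite // !inE ne.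
Qed.
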